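(* Let $p$ be a prime and $0<\epsilon<1$. There exists a positive constant $\tilde c$ depending only on $\alpha_0,\dots,\alpha_m$ and $\epsilon$ such that the following holds. If $\beta=a/b\in\mathbb{Q}\setminus\{0\}$ with integers $a$, $b\ge1$ satisfies \[ \gcd(a,b)=1,\qquad |a|^\epsilon>\tilde c\,b^{2(m+1+\epsilon)},\qquad |a|_p<\min\left\{2^{-\delta(2,p)}|s|_p,\ |a|^{-1+\epsilon/(8(m+1))}\right\}, \] then there is a constant $\tilde H_0>0$ (depending on $\alpha_0,\dots,\alpha_m,\beta,\epsilon$ and $p$) such that \[ |\ell_0+\ell_1\varphi_1(\beta)+\cdots+\ell_m\varphi_m(\beta)|_p>\tilde H^{-1-\epsilon} \] for all $(\ell_0,\ell_1,\dots,\ell_m)\in\mathbb{Z}^{m+1}\setminus\{0\}$ with $\tilde H\ge\tilde H_0$.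
   Context: Let $m\ge1$ and let $\alpha_0,\alpha_1,\dots,\alpha_m$ be positive rational numbers with $\alpha_i-\alpha_j\notin\mathbb{Z}$ for $1\le i<j\le m$. Pochhammer symbol: $(x)_0=1$, $(x)_n=x(x+1)\cdots(x+n-1)$. $\varphi_j(z)=\sum_{n\ge0}\frac{(\alpha_j)_n}{(\alpha_j+\alpha_0)_n}z^n$; $\varphi_j(\beta)\in\mathbb{Q}_p$ denotes the $p$-adic sum (the series converge $p$-adically when $|\beta|_p<2^{-\delta(2,p)}|s|_p$). Write $\alpha_j=r_j/s_j$ in lowest terms ($j=1,\dots,m$) and let $s=\operatorname{lcm}(s_1,\dots,s_m)$. $|\cdot|_p$ is the $p$-adic absolute value with $|p|_p=p^{-1}$; $\delta(2,p)=1$ if $p=2$ and $s$ is even, $0$ otherwise. For $(\ell_0,\dots,\ell_m)\in\mathbb{Z}^{m+1}$: $h_0=\max\{|\ell_0|,\dots,|\ell_m|\}$, $h_j=\max\{1,|\ell_j|\}$ ($j=1,\dots,m$), $\tilde H=\prod_{j=0}^mh_j$. *)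

(* Defs.v *)
From Stdlib Require Import Reals ZArith QArith Qreals List Znumtheory.
Open Scope R_scope.

(* p-adic valuation of an integer (value irrelevant for n = 0). Fuel |n| suffices for p >= 2. *)
Fixpoint vpZ_aux (fuel : nat) (p n : Z) : nat :=
  match fuel with
  | O => O
  | S f => if andb (negb (Z.eqb n 0)) (Z.eqb (Z.modulo n p) 0)
           then S (vpZ_aux f p (Z.div n p)) else O
  end.
Definition vpZ (p n : Z) : nat := vpZ_aux (Z.to_nat (Z.abs n)) p n.

Definition padicQ (p : Z) (q : Q) : R :=
  if Z.eqb (Qnum q) 0 then 0
  else powerRZ (IZR p) (Z.of_nat (vpZ p (Zpos (Qden q))) - Z.of_nat (vpZ p (Qnum q))).

Fixpoint poch (x : Q) (n : nat) : Q :=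
  match n with
  | O => 1%Q
  | S k => (poch x k * (x + inject_Z (Z.of_nat k)))%Q
  end.

Definition phi_partial (a0 aj z : Q) (N : nat) : Q :=
  fold_right Qplus 0%Q
    (map (fun n => (poch aj n / poch (aj + a0) n * Qpower z (Z.of_nat n))%Q) (seq 0 N)).

Definition s_lcm (alpha : nat -> Q) (m : nat) : Z :=
  fold_right Z.lcm 1%Z (map (fun j => Zpos (Qden (Qred (alpha j)))) (seq 1 m)).

Definition delta2 (p s : Z) : Z := if andb (Z.eqb p 2) (Z.even s) then 1%Z else 0%Z.

Definition h0 (l : nat -> Z) (m : nat) : Z :=
  fold_right Z.max 0%Z (map (fun j => Z.abs (l j)) (seq 0 (S m))).

Definition Htilde (l : nat -> Z) (m : nat) : Z :=
  (h0 l m * fold_right Z.mul 1%Z (map (fun j => Z.max 1 (Z.abs (l j))) (seq 1 m)))%Z.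

Definition linform_partial (alpha : nat -> Q) (m : nat) (l : nat -> Z) (beta : Q) (N : nat) : Q :=
  (inject_Z (l 0%nat) +
   fold_right Qplus 0%Q
     (map (fun j => inject_Z (l j) * phi_partial (alpha 0%nat) (alpha j) beta N) (seq 1 m)))%Q.

(* Main.v *)
(** Idea. Write c = alpha_0.  Given indices n_0 >= n_j with sum N, the type II Pade problem
    Q phi_j - P_j = O(z^(N+1)) with deg P_j <= N - n_j and deg Q <= N - n_0 has an explicit
    (Jacobi-Pineiro) solution: up to a nonzero factor, the coefficients of Q phi_j are the values
    at alpha_j + r of a polynomial G, and G is chosen to vanish where the coefficients have to.
    Expanding G in the basis (x)_i (x+c+i)_(D-i) gives Q; its coefficients, and a common
    denominator of everything involved, are at most exponential in N (for the denominators
    because lcm(1..n) <= 16^n).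

    Lowering each of the m+1 indices by one in turn gives a matrix of approximants whose
    determinant is a nonzero multiple of a power of z, so some row yields a nonzero integer
    Z = Q(beta) Lambda - (a p-adically small remainder), after clearing denominators.  Its absolute
    value is O(C^N) times max_j |l_j| |a|^(N-n_j) b^(n_j); choosing n_j so that
    (|a|/b)^(n_j) is about h_j H^delta balances the terms and makes the remainder p-adically
    smaller than 1/|Z|.  Hence |Lambda|_p >= |Z|_p >= 1/|Z|. *)

From mathcomp Require all_boot all_order all_algebra perm.
From mathcomp Require zify ring lra ssrZ.

(** The obstacle is the p-adic remainder. Each phi_j is replaced by a partial sum of arbitrary
    length T >= N, so no limit is formed, but every term of degree i >= N must be bounded uniformly
    in T. The coefficients are quotients of two binomials. The one at alpha_j costs v_p(s) + 1/(p-1)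
    per degree if p | s, and nothing otherwise; the reciprocal of the one at alpha_j + c costs only
    a logarithm, being essentially an iterated difference of 1/x. Hence only the denominators of
    alpha_1, ..., alpha_m enter the condition on |a|_p, and delta(2,p) reflects 1/(p-1) = 1 at p =
    2.

    Constants: with delta = eps/(4(m+1)), the gain H^delta must pay for the loss |a|^(N
    eps/(8(m+1))) in |a|_p and for C^(2N), which the size of |a| keeps below |a|^(N eps/(50(m+1))).
    The condition on b makes |a|^N at most about H^(1+eps/2), so 1/4 has to beat (1/8 + 1/50) times
    3/2. *)

Module PadeCore.
Import all_boot all_order all_algebra perm zify ring lra.
Set Implicit Arguments. Unset Strict Implicit. Unset Printing Implicit Defensive.
Import Order.TTheory GRing.Theory Num.Theory.
Local Open Scope ring_scope.

(** * Least common multiples and factorials *)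

Fixpoint lcmto (n : nat) : nat := if n is k.+1 then lcmn (lcmto k) n else 1%N.

Lemma lcmto_gt0 n : (0 < lcmto n)%N.
Proof. by elim: n => //= n IH; rewrite lcmn_gt0 IH. Qed.

Lemma dvdn_lcmto k n : (0 < k <= n)%N -> (k %| lcmto n)%N.
Proof.
elim: n => [|n IH] /andP[k0 kn]; first by case: k k0 kn.
rewrite /=; move: kn; rewrite leq_eqVlt => /orP[/eqP <-|kn]; first exact: dvdn_lcmr.
by apply: (dvdn_trans (IH _)); rewrite ?k0 //; apply: dvdn_lcml.
Qed.

Lemma lcmto_dvd d n : (forall k, (0 < k <= n)%N -> (k %| d)%N) -> (lcmto n %| d)%N.
Proof.
elim: n => [|n IH] /= H; first exact: dvd1n.
rewrite dvdn_lcm (H n.+1) ?leqnn ?andbT //; apply: IH => k /andP[k0 kn].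
by apply: H; rewrite k0 ltnW.
Qed.

(** In Legendre's formula for (2n)!/(n!)^2 every term floor(2n/p^k) - 2 floor(n/p^k) is nonnegative,
    and the term k = e equals 1. *)
Lemma prime_power_dvd_bin p e n : prime p -> (n < p ^ e <= n.*2)%N ->
  (p %| 'C(n.*2, n))%N.
Proof.
move=> pp /andP[lo hi].
have b0 : (0 < 'C(n.*2, n))%N by rewrite bin_gt0 -addnn leq_addr.
have := bin_fact (leq_addr n n); rewrite addnK addnn => E.
have := congr1 (logn p) E; rewrite !lognM ?muln_gt0 ?fact_gt0 //.
rewrite !logn_fact //.
have e0 : (0 < e)%N by case: e hi lo => [|//]; rewrite expn0; lia.
have ltpe k : (k < p ^ k)%N by apply: ltn_expl; exact: prime_gt1.
have en : (e < n.*2.+1)%N by rewrite ltnS; apply: leq_trans hi; apply: ltnW.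
have ext : (\sum_(1 <= k < n.+1) n %/ p ^ k = \sum_(1 <= k < n.*2.+1) n %/ p ^ k)%N.
  rewrite [RHS](@big_cat_nat _ _ _ n.+1) //=; last by rewrite ltnS -addnn leq_addr.
  rewrite -[LHS]addn0; congr addn; rewrite big_nat big1 // => k /andP[nk _].
  by rewrite divn_small //; apply: ltn_trans (ltpe k).
rewrite ext => H.
rewrite (_ : (p %| _)%N = (0 < logn p 'C(n.*2, n))%N); last first.
  by rewrite logn_gt0 mem_primes pp b0.
have : (\sum_(1 <= k < n.*2.+1) n %/ p ^ k + \sum_(1 <= k < n.*2.+1) n %/ p ^ k
    + \sum_(1 <= k < n.*2.+1) (k == e) <= \sum_(1 <= k < n.*2.+1) n.*2 %/ p ^ k)%N.
  rewrite -!big_split /= leq_sum // => k _.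
  case: eqP => [->|_].
    by rewrite divn_small // !add0n divn_gt0 // expn_gt0 prime_gt0.
  have := leq_trunc_div n (p ^ k); rewrite addn0 addnn => H1.
  by rewrite leq_divRL ?expn_gt0 ?prime_gt0 // -doubleMl leq_double.
have -> : (\sum_(1 <= k < n.*2.+1) (k == e) = 1)%N.
  rewrite (bigD1_seq e) /= ?mem_index_iota ?e0 ?iota_uniq // eqxx big1 // => i /negbTE -> //.
lia.
Qed.

(** A prime power p^e <= 2n that exceeds n still has p^(e-1) <= n; [lcmto n] supplies p^(e-1) and
    the binomial coefficient the missing p. *)
Lemma lcmto_double n : (lcmto n.*2 %| lcmto n * 'C(n.*2, n))%N.
Proof.
apply: lcmto_dvd => k /andP[k0 kn].
apply/dvdn_partP => // p; rewrite mem_primes => /and3P[pp _ pk].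
rewrite p_part; set e := logn p k.
have pe : (p ^ e <= n.*2)%N by apply: leq_trans kn; apply: dvdn_leq => //; apply: pfactor_dvdnn.
have pe0 : (0 < p ^ e)%N by rewrite expn_gt0 prime_gt0.
case: (leqP (p ^ e) n) => H.
  by apply: dvdn_mulr; apply: dvdn_lcmto; rewrite pe0.
have pb := @prime_power_dvd_bin p e n pp; rewrite H pe in pb.
case: e pe pe0 H pb => [|e] pe pe0 H pb; first by rewrite expn0 dvd1n.
rewrite expnSr; apply: dvdn_mul; last exact: pb.
apply: dvdn_lcmto; rewrite expn_gt0 prime_gt0 //=.
move: pe (prime_gt1 pp); rewrite expnS; nia.
Qed.

Lemma bin_leq_exp2 n k : ('C(n, k) <= 2 ^ n)%N.
Proof.
elim: n k => [|n IH] [|k] //; first by rewrite bin0 expn_gt0.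
by rewrite binS expnS mul2n -addnn leq_add.
Qed.

(** Doubling gives lcm(1..2k) <= 16^k 4^k = 64^k, which is smaller than 16^(2k) by 4^k; this slack
    absorbs the factor 2k+1 of the odd case. *)
Lemma lcmto_leq n : (lcmto n <= 16 ^ n)%N.
Proof.
elim/ltn_ind: n => n IH.
have [->//|n0] := posnP n.
set k := n./2; have kn : (k < n)%N by rewrite /k; lia.
have dbl : (lcmto k.*2 <= 64 ^ k)%N.
  apply: (leq_trans (dvdn_leq _ (lcmto_double k))).
    by rewrite muln_gt0 lcmto_gt0 bin_gt0 -addnn leq_addr.
  rewrite (_ : 64 = 16 * 4)%N // expnMn; apply: leq_mul; first exact: IH.
  by apply: (leq_trans (bin_leq_exp2 _ _)); rewrite -mul2n expnM.
have e1 : (64 ^ k * 4 ^ k = 16 ^ k.*2)%N by rewrite -expnMn -mul2n expnM.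
have k4 : (k < 4 ^ k)%N by apply: ltn_expl.
have : n = (odd n + k.*2)%N by rewrite /k odd_double_half.
case: (odd n) => /= ->; rewrite ?add1n ?add0n.
- apply: (@leq_trans (lcmto k.*2 * k.*2.+1)).
    apply: dvdn_leq; first by rewrite muln_gt0 lcmto_gt0.
    by rewrite dvdn_lcm dvdn_mulr ?dvdn_mull.
  rewrite expnS -e1; nia.
- apply: (leq_trans dbl); rewrite -e1; apply: leq_pmulr; rewrite expn_gt0 //.
Qed.

Lemma logn_fact_le p n : prime p -> (p.-1 * logn p n`! <= n)%N.
Proof.
move=> pp; rewrite logn_fact //.
(* Carrying floor(n/p^K) along makes the sum telescope, since p floor(n/p^(K+1)) <= floor(n/p^K). *)
suff H K : (p.-1 * (\sum_(1 <= k < K.+1) n %/ p ^ k) + n %/ p ^ K <= n)%N.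
  by apply: leq_trans (H n); apply: leq_addr.
elim: K => [|K IH]; first by rewrite big_geq // muln0 expn0 divn1.
rewrite big_nat_recr //= mulnDr -addnA.
have := leq_trunc_div (n %/ p ^ K) p; rewrite -divnMA -expnSr.
have := prime_gt1 pp; move: IH.
set S := (\sum_(1 <= k < K.+1) _)%N; nia.
Qed.

Lemma fact_dvd_consecutive n x : (n`! %| \prod_(l < n) (x + l))%N.
Proof.
elim: n x => [|n IHn] x; first by rewrite dvd1n.
elim: x => [|x IHx]; first by rewrite big_ord_recl /= mul0n dvdn0.
have -> : (\prod_(l < n.+1) (x.+1 + l) =
  \prod_(l < n.+1) (x + l) + n.+1 * \prod_(l < n) (x.+1 + l))%N.
  rewrite big_ord_recr [in RHS]big_ord_recl /= addn0.
  under [X in (x * X)%N]eq_bigr => i _ do rewrite /bump /= add1n addnS -addSn.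
  by rewrite -mulnDl addSnnS mulnC.
by rewrite dvdn_add // factS dvdn_mul.
Qed.

(* Multiplying by an inverse of v modulo A makes the progression consecutive. *)
Lemma coprime_fact_dvd A n u v : coprime A v -> (A %| n`!)%N ->
  (A %| \prod_(l < n) (u + l * v))%N.
Proof.
have [->|v0] := posnP v.
  rewrite /coprime gcdn0 => /eqP -> _; exact: dvd1n.
move=> Av An.
have [w k E _] := egcdnP A v0; rewrite gcdnC (eqP Av) in E.
have Aw : coprime A w.
  apply/eqP; apply/eqP; rewrite -dvdn1.
  rewrite -(@dvdn_addr (k * A)); last by rewrite dvdn_mull // dvdn_gcdl.
  by rewrite -E dvdn_mulr // dvdn_gcdr.
rewrite -(@Gauss_dvdr _ (w ^ n)) ?coprimeXr //.
have -> : (w ^ n = \prod_(l < n) w)%N by rewrite prod_nat_const card_ord.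
rewrite -big_split /=.
have H : (\prod_(l < n) (w * (u + l * v)) = \prod_(l < n) (w * u + l) %[mod A])%N.
  elim/big_ind2: _ => // [x1 x2 y1 y2 E1 E2|l _]; first by rewrite -modnMm E1 E2 modnMm.
  rewrite mulnDr mulnCA E mulnDr muln1 addnCA mulnA -modnDml modnMl add0n addnC //.
by rewrite /dvdn H; apply: dvdn_trans An _; exact: fact_dvd_consecutive.
Qed.

(** Prime by prime: if p | v, then v^n contains p^n and v_p(n!) <= n; otherwise v is invertible
    modulo the p-part of n!. *)
Lemma fact_dvd_progression n u v : (n`! %| v ^ n * \prod_(l < n) (u + l * v))%N.
Proof.
apply/dvdn_partP => [|p]; first exact: fact_gt0.
rewrite mem_primes => /and3P[pp _ _]; rewrite p_part.
have [pv|pv] := boolP (p %| v)%N.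
  apply: dvdn_mulr; apply: dvdn_trans (dvdn_exp2r n pv).
  apply: dvdn_exp2l; apply: leq_trans (logn_fact_le n pp).
  by apply: leq_pmull; have := prime_gt1 pp; lia.
apply: dvdn_mull; apply: coprime_fact_dvd; last exact: pfactor_dvdnn.
by rewrite coprimeXl // prime_coprime.
Qed.

Lemma fact_dvdz_progression n (u : int) (v : nat) :
  ((n`!)%:Z %| (v ^ n)%:Z * \prod_(l < n) (u + l%:Z * v%:Z))%Z.
Proof.
(* [u'] is congruent to u modulo n! and nonnegative before [absz], which reduces the claim to
   natural numbers. *)
pose u' := absz (u + n`!%:Z * (absz u)%:Z).
have u'E : u'%:Z = u + n`!%:Z * (absz u)%:Z.
  rewrite /u'; have := fact_gt0 n; set f := n`!; nia.
have dv : ((n`!)%:Z %| \prod_(l < n) (u'%:Z + l%:Z * v%:Z)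
              - \prod_(l < n) (u + l%:Z * v%:Z))%Z.
  elim/big_ind2: _ => [|x1 x2 y1 y2 E1 E2|l _]; first by rewrite subrr dvdz0.
    have -> : x2 * y2 - x1 * y1 = (x2 - x1) * y2 + x1 * (y2 - y1) by ring.
    by apply: rpredD; [apply: dvdz_mulr|apply: dvdz_mull].
  by rewrite u'E (_ : _ - _ = n`!%:Z * (absz u)%:Z) ?dvdz_mulr //; ring.
rewrite -[\prod_(l < n) (u + _)](subKr (\prod_(l < n) (u'%:Z + l%:Z * v%:Z))) mulrBr.
apply: rpredB; last by apply: dvdz_mull.
have -> : \prod_(l < n) (u'%:Z + l%:Z * v%:Z) = (\prod_(l < n) (u' + l * v))%N%:Z.
  by elim/big_ind2: _ => // x1 x2 y1 y2 -> ->; rewrite PoszM.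
by rewrite -PoszM; apply: fact_dvd_progression.
Qed.

(** * Rising factorials *)

Definition rising (x : rat) (n : nat) : rat := \prod_(l < n) (x + l%:R).
(* The binomial coefficient (x + n - 1 choose n), that is (-1)^n (-x choose n). *)
Definition mbin (x : rat) (n : nat) : rat := rising x n / n`!%:R.

Lemma rising0 x : rising x 0 = 1. Proof. exact: big_ord0. Qed.
Lemma risingS x n : rising x n.+1 = rising x n * (x + n%:R).
Proof. by rewrite /rising big_ord_recr. Qed.
Lemma risingSl x n : rising x n.+1 = x * rising (x + 1) n.
Proof.
rewrite /rising big_ord_recl addr0; congr (_ * _); apply: eq_bigr => i _.
by rewrite /= /bump /= add1n -natr1 -addrA [1 + _]addrC.
Qed.

Lemma risingD x m n : rising x (m + n) = rising x m * rising (x + m%:R) n.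
Proof.
elim: n => [|n IH]; first by rewrite addn0 rising0 mulr1.
by rewrite addnS !risingS IH natrD -mulrA addrA.
Qed.

Lemma rising_neq0 x n : (forall l, (l < n)%N -> x + l%:R != 0) -> rising x n != 0.
Proof. by move=> H; apply/prodf_neq0 => i _; apply: H. Qed.

Lemma rising_gt0 x n : 0 < x -> 0 < rising x n.
Proof. by move=> x0; apply: prodr_gt0 => i _; apply: ltr_pwDl. Qed.

Lemma rising_opp_nat k i : (i <= k)%N ->
  rising (- k%:R) i = (-1) ^+ i * (k`!%:R / (k - i)`!%:R).
Proof.
elim: i => [|i IH] ik.
  by rewrite rising0 subn0 divff ?mulr1 // pnatr_eq0 -lt0n fact_gt0.
rewrite risingS IH ?(ltnW ik) //.
have -> : (k - i = (k - i.+1).+1)%N by lia.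
have -> : - k%:R + i%:R = - (k - i.+1).+1%:R :> rat.
  by rewrite -[in LHS](subnK ik) addnS -addSn natrD; ring.
rewrite factS natrM exprS.
have f0 : (k - i.+1)`!%:R != 0 :> rat by rewrite pnatr_eq0 -lt0n fact_gt0.
by field; rewrite f0 addrC natr1 pnatr_eq0.
Qed.

Lemma rising_opp_nat_eq0 k i : (k < i)%N -> rising (- k%:R) i = 0.
Proof.
by move=> ki; apply/eqP/prodf_eq0; exists (Ordinal ki) => //=; rewrite addNr.
Qed.

Lemma rising_reflect c r : rising (c - r%:R) r = (-1) ^+ r * rising (1 - c) r.
Proof.
elim: r => [|r IH]; first by rewrite !rising0 expr0 mulr1.
rewrite risingSl [in RHS]risingS exprS.
have -> : c - r.+1%:R + 1 = c - r%:R by rewrite -natr1; ring.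
by rewrite IH -natr1; ring.
Qed.

Lemma mbin0 x : mbin x 0 = 1. Proof. by rewrite /mbin rising0 divr1. Qed.

Lemma mbinS x n : mbin x n.+1 = mbin x n * ((x + n%:R) / n.+1%:R).
Proof.
rewrite /mbin risingS factS natrM.
have f0 : n`!%:R != 0 :> rat by rewrite pnatr_eq0 -lt0n fact_gt0.
by field; rewrite f0 addrC natr1 pnatr_eq0.
Qed.

Lemma mbinSM x n : n.+1%:R * mbin x n.+1 = (x + n%:R) * mbin x n.
Proof.
rewrite mbinS mulrC -mulrA divfK ?pnatr_eq0 //; exact: mulrC.
Qed.

Lemma mbin_zero n : mbin 0 n = (n == 0%N)%:R.
Proof. by case: n => [|n]; rewrite ?mbin0 // /mbin risingSl !mul0r. Qed.

(** [mbin x n] is the coefficient of t^n in (1-t)^(-x). Splitting n+1 = i + (n+1-i) is the product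
    rule for the derivative in t, read coefficientwise. *)
Lemma mbin_vandermonde x y n :
  \sum_(i < n.+1) mbin x i * mbin y (n - i) = mbin (x + y) n.
Proof.
elim: n => [|n IH]; first by rewrite big_ord1 !mbin0 mulr1.
apply: (@mulfI _ n.+1%:R); first by rewrite pnatr_eq0.
rewrite mbinSM -IH !mulr_sumr.
have -> : \sum_(i < n.+2) n.+1%:R * (mbin x i * mbin y (n.+1 - i)) =
  \sum_(i < n.+2) i%:R * mbin x i * mbin y (n.+1 - i) +
  \sum_(i < n.+2) mbin x i * ((n.+1 - i)%:R * mbin y (n.+1 - i)).
  rewrite -big_split /=; apply: eq_bigr => i _.
  have -> : n.+1%:R = i%:R + (n.+1 - i)%:R :> rat by rewrite -natrD subnKC ?leq_ord.
  ring.
rewrite big_ord_recl /= !mul0r add0r [X in _ + X]big_ord_recr /= subnn mul0r mulr0 addr0.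
rewrite -big_split /=; apply: eq_bigr => i _; rewrite /bump /= add1n subSS.
rewrite mbinSM subSn ?leq_ord // mbinSM natrB ?leq_ord //; ring.
Qed.

Lemma mbinD1 x n : mbin (x + 1) n.+1 = mbin x n.+1 + mbin (x + 1) n.
Proof.
rewrite [in LHS]mbinS {1}/mbin [mbin x n.+1]/mbin risingSl factS natrM /mbin.
have f0 : n`!%:R != 0 :> rat by rewrite pnatr_eq0 -lt0n fact_gt0.
by field; rewrite f0 addrC natr1 pnatr_eq0.
Qed.

Lemma mbin_ge0 x n : 0 <= x -> 0 <= mbin x n.
Proof.
by move=> x0; rewrite divr_ge0 ?ler0n // prodr_ge0 // => i _; rewrite addr_ge0.
Qed.

Lemma mbin_nat_le X n : mbin X%:R n <= 2%:R ^+ (X + n).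
Proof.
elim: X n => [|X IH] n.
  by rewrite mbin_zero; case: n => //= n; rewrite exprn_ge0.
elim: n => [|n IHn].
  by rewrite mbin0 exprn_ege1 // ler1n.
rewrite -natr1 mbinD1 natr1 addSn exprS mulr2n mulrDl mul1r lerD //.
by rewrite addnS -addSn.
Qed.

Lemma mbin_mono x y n : 0 <= x <= y -> mbin x n <= mbin y n.
Proof.
move=> /andP[x0 xy]; rewrite ler_wpM2r ?invr_ge0 ?ler0n //.
by apply: ler_prod => i _; rewrite addr_ge0 ?lerD2r.
Qed.

Lemma mbin_norm_le x A n : `|x| <= A -> `|mbin x n| <= (A + 1) ^+ n.
Proof.
move=> xA; elim: n => [|n IH]; first by rewrite mbin0 normr1 expr0.
rewrite mbinS normrM exprSr ler_pM // normrM normfV [`|n.+1%:R|]ger0_norm ?ler0n //.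
rewrite ler_pdivrMr ?ltr0n // (le_trans (ler_normD _ _)) // [`|n%:R|]ger0_norm ?ler0n //.
have A0 : 0 <= A := le_trans (normr_ge0 x) xA.
have n0 : 0 <= n%:R :> rat by [].
rewrite -natr1; nra.
Qed.

Lemma mbin_inv_le (x B : rat) n : 0 < x -> x^-1 <= B -> (mbin x n)^-1 <= (B + 1) ^+ n.
Proof.
move=> x0 xB; have B0 : 0 <= B by apply: le_trans xB; rewrite invr_ge0 ltW.
elim: n => [|n IH]; first by rewrite mbin0 invr1 expr0.
have n0 : 0 <= n%:R :> rat by [].
have xn : 0 < x + n%:R by rewrite ltr_pwDl.
rewrite mbinS invfM exprSr; apply: ler_pM => //.
- by rewrite invr_ge0 mbin_ge0 // ltW.
- by rewrite invr_ge0 divr_ge0 // ltW.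
have Bx : 1 <= B * x by rewrite -ler_pdivrMr // div1r.
rewrite invf_div ler_pdivrMr // -natr1; nra.
Qed.

(** One v^n clears the denominators of the n factors u/v + l; the other is what n! needs to divide
    the product of the u + l v. *)
Lemma mbin_int (u : int) (v n : nat) : (0 < v)%N ->
  v%:R ^+ (2 * n) * mbin (u%:~R / v%:R) n \is a Num.int.
Proof.
move=> v0; have /dvdzP[k E] := fact_dvdz_progression n u v.
have vn : v%:R != 0 :> rat by rewrite pnatr_eq0 -lt0n.
have f0 : n`!%:R != 0 :> rat by rewrite pnatr_eq0 -lt0n fact_gt0.
suff -> : v%:R ^+ (2 * n) * mbin (u%:~R / v%:R) n = k%:~R by apply: intr_int.
apply: (mulIf f0); rewrite /mbin mulrA divfK //.
have -> : k%:~R * n`!%:R = (k * n`!%:Z)%:~R :> rat by rewrite intrM.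
rewrite -E intrM /rising mul2n -addnn exprD -mulrA; congr (_ * _).
  by rewrite -pmulrn natrX.
have -> : v%:R ^+ n = \prod_(l < n) (v%:R : rat) by rewrite prodr_const card_ord.
rewrite -big_split /= (big_morph _ (@intrM rat) (erefl _)); apply: eq_bigr => l _.
by rewrite intrD intrM -!pmulrn; field.
Qed.

(* c n!/(x)_{n+1} is the n-th iterated difference of c/x. *)
Lemma fact_div_rising (S : rat -> Prop) c :
  (forall x y, S x -> S y -> S (x - y)) ->
  forall n x, (forall l, (l <= n)%N -> x + l%:R != 0) ->
  (forall l, (l <= n)%N -> S (c / (x + l%:R))) ->
  S (c * n`!%:R / rising x n.+1).
Proof.
move=> SB; elim=> [|n IH] x nz H.
  by have := H 0%N isT; rewrite risingS rising0 mul1r mulr1.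
have sh l : x + l.+1%:R = x + 1 + l%:R by rewrite -natr1; ring.
have -> : c * n.+1`!%:R / rising x n.+2 =
   c * n`!%:R / rising x n.+1 - c * n`!%:R / rising (x + 1) n.+1.
  rewrite [rising x n.+2]risingS [rising x n.+1]risingSl (risingS (x + 1)) factS natrM.
  have h0 := nz 0%N isT; rewrite addr0 in h0.
  have h1 := nz n.+1 (leqnn _); rewrite sh in h1.
  have h2 : rising (x + 1) n != 0.
    by apply: rising_neq0 => l ln; rewrite -sh nz // ltnS ltnW.
  by rewrite sh -natr1; field; rewrite h0 h1 h2.
apply: SB; apply: IH => l ln; rewrite -?sh; [apply: nz|apply: H|apply: nz|apply: H] => //; exact: leqW.
Qed.

(** * Interpolation at 0, -1, ..., -D *)

Lemma convolutionA (f g h : nat -> rat) n :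
  \sum_(i < n.+1) (\sum_(k < i.+1) f k * g (i - k)%N) * h (n - i)%N =
  \sum_(k < n.+1) f k * \sum_(j < (n - k).+1) g j * h (n - k - j)%N.
Proof.
pose P (u : nat -> rat) := \poly_(i < n.+1) u i.
have PE u i : (i <= n)%N -> (P u)`_i = u i by move=> i_n; rewrite coef_poly ltnS i_n.
transitivity ((P f * P g * P h)`_n).
  rewrite coefM; apply: eq_bigr => i _; rewrite (PE h) ?leq_subr // coefM; congr (_ * _).
  apply: eq_bigr => k _; rewrite !PE //; first exact: leq_trans (leq_subr _ _) (leq_ord i).
  exact: leq_trans (leq_ord k) (leq_ord i).
rewrite -mulrA coefM; apply: eq_bigr => k _; rewrite PE ?leq_ord // coefM; congr (_ * _).
apply: eq_bigr => j _; rewrite !PE //.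
  by rewrite -subnDA leq_subr.
exact: leq_trans (leq_ord j) (leq_subr _ _).
Qed.

(* Coefficients of G in the basis (x)_i (x + c + i)_(D - i).  Evaluating such an expansion at
   x = -n gives a convolution with the coefficients of (1 - t)^(c - 1); this is its inverse. *)
Definition expcoef (c : rat) (D : nat) (G : {poly rat}) (i : nat) : rat :=
  \sum_(k < i.+1) (-1) ^+ k * (G.[- k%:R] / (k`!%:R * rising c (D - k))) * mbin (c - 1) (i - k).

(** The series (1-t)^(1-c) and (1-t)^(c-1) are inverse to each other, so the convolution that
    defines [expcoef] is undone. *)
Lemma expcoef_conv c D G n :
  \sum_(i < n.+1) expcoef c D G i * mbin (1 - c) (n - i) =
  (-1) ^+ n * (G.[- n%:R] / (n`!%:R * rising c (D - n))).
Proof.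
rewrite /expcoef (convolutionA (fun k => (-1) ^+ k * (G.[- k%:R] / (k`!%:R * rising c (D - k))))
  (mbin (c - 1)) (mbin (1 - c))).
rewrite big_ord_recr /= big1 ?add0r => [|k _].
  by rewrite subnn big_ord1 !mbin0 !mulr1.
rewrite mbin_vandermonde (_ : _ + _ = 0); last by ring.
by rewrite mbin_zero subn_eq0 leqNgt ltn_ord mulr0.
Qed.

(** At x = -n the terms i > n vanish. For the others (-n+c+i)_(D-i) = (c-(n-i))_(n-i) (c)_(D-n), and
    reflecting the first factor produces [mbin (1 - c) (n - i)]. *)
Lemma expcoef_eval c D G n : 0 < c -> (n <= D)%N ->
  \sum_(i < D.+1) expcoef c D G i * (rising (- n%:R) i * rising (- n%:R + c + i%:R) (D - i))
    = G.[- n%:R].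
Proof.
move=> c0 nD.
rewrite -(big_mkord xpredT (fun i => expcoef c D G i *
  (rising (- n%:R) i * rising (- n%:R + c + i%:R) (D - i)))).
rewrite (@big_cat_nat _ _ _ n.+1) //= [X in _ + X]big_nat [X in _ + X]big1 ?addr0; last first.
  by move=> i /andP[ni _]; rewrite rising_opp_nat_eq0 // mul0r mulr0.
rewrite big_mkord.
transitivity ((-1) ^+ n * n`!%:R * rising c (D - n) *
  \sum_(i < n.+1) expcoef c D G i * mbin (1 - c) (n - i)).
  rewrite mulr_sumr; apply: eq_bigr => i _; have i_n := leq_ord i.
  rewrite rising_opp_nat //.
  have -> : - n%:R + c + i%:R = c - (n - i)%:R by rewrite natrB //; ring.
  have -> : (D - i = n - i + (D - n))%N by lia.
  rewrite risingD subrK rising_reflect /mbin.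
  have -> : (-1) ^+ n = (-1) ^+ i * (-1) ^+ (n - i) :> rat by rewrite -exprD subnKC.
  ring.
have f0 : n`!%:R != 0 :> rat by rewrite pnatr_eq0 -lt0n fact_gt0.
have r0 : rising c (D - n) != 0 by rewrite gt_eqF // rising_gt0.
rewrite expcoef_conv; move: (signrMK n G.[- n%:R]) => E.
rewrite -[RHS]E; field; rewrite f0 r0 //.
Qed.

Definition risingP (s : rat) (n : nat) : {poly rat} := \prod_(l < n) ('X + (s + l%:R)%:P).

Lemma size_risingP s n : size (risingP s n) = n.+1.
Proof.
rewrite /risingP; have := size_prod_XsubC (index_enum 'I_n) (fun l : 'I_n => - (s + l%:R)).
under eq_bigr do rewrite polyCN opprK.
by move=> ->; rewrite -[index_enum _]enumT size_enum_ord.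
Qed.

Lemma horner_risingP s n x : (risingP s n).[x] = rising (x + s) n.
Proof.
by rewrite horner_prod; apply: eq_bigr => l _; rewrite hornerD hornerX hornerC addrA.
Qed.

(** Both sides are polynomials in x of degree at most D that agree at the D+1 points 0, -1, ...,
    -D. *)
Lemma expcoefE c D (G : {poly rat}) x : 0 < c -> (size G <= D.+1)%N ->
  \sum_(i < D.+1) expcoef c D G i * (rising x i * rising (x + c + i%:R) (D - i)) = G.[x].
Proof.
move=> c0 sG.
pose L : {poly rat} := \sum_(i < D.+1) expcoef c D G i *:
   (risingP 0 i * risingP (c + i%:R) (D - i)).
have LE y : L.[y] =
  \sum_(i < D.+1) expcoef c D G i * (rising y i * rising (y + c + i%:R) (D - i)).
  rewrite horner_sum; apply: eq_bigr => i _.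
  by rewrite hornerZ hornerM !horner_risingP addr0 addrA.
suff LG : L - G = 0 by rewrite -LE; move/eqP: LG; rewrite subr_eq0 => /eqP ->.
apply: (@roots_geq_poly_eq0 _ _ [seq - n%:R | n <- iota 0 D.+1]).
- apply/allP => _ /mapP[n nD ->]; move: nD; rewrite mem_iota add0n ltnS => nD.
  by rewrite /root hornerD hornerN LE expcoef_eval // subrr.
- rewrite map_inj_uniq ?iota_uniq // => i j /oppr_inj /eqP; rewrite eqr_nat => /eqP //.
rewrite size_map size_iota; apply: leq_trans (size_polyD _ _) _.
rewrite size_polyN geq_max sG andbT; apply: leq_trans (size_sum _ _ _) _.
apply/bigmax_leqP => i _; apply: leq_trans (size_scale_leq _ _) _.
apply: leq_trans (size_polyMleq _ _) _; rewrite !size_risingP; have := leq_ord i; lia.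
Qed.

Definition hcoef (c x : rat) (n : nat) : rat := rising x n / rising (x + c) n.

(** The basis is made for this: [hcoef c x (r + i)] is a factor independent of i times the i-th
    basis polynomial at x + r. *)
Lemma expcoef_hcoef c D (G : {poly rat}) x r : 0 < c -> 0 < x -> (size G <= D.+1)%N ->
  \sum_(i < D.+1) expcoef c D G i * hcoef c x (r + i) =
  rising x r / rising (x + c) (r + D) * G.[x + r%:R].
Proof.
move=> c0 x0 sG; rewrite -(expcoefE _ c0 sG) mulr_sumr; apply: eq_bigr => i _.
have iD : (i <= D)%N := leq_ord i.
rewrite /hcoef; have -> : (r + D = r + i + (D - i))%N by lia.
rewrite !risingD.
have -> : x + c + (r + i)%:R = x + r%:R + c + i%:R by rewrite natrD; ring.
have -> : x + r%:R + c = x + c + r%:R by ring.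
have h (y : rat) k : 0 < y -> rising y k != 0 by move=> y0; rewrite gt_eqF // rising_gt0.
have xc : 0 < x + c by rewrite addr_gt0.
have xcr : 0 < x + c + r%:R by rewrite ltr_pwDl.
field; rewrite !h //; by rewrite ltr_pwDl.
Qed.

(** * Pade approximants *)

Lemma coef_mul_top (p q : {poly rat}) a b : (size p <= a.+1)%N -> (size q <= b.+1)%N ->
  (p * q)`_(a + b) = p`_a * q`_b.
Proof.
move=> sp sq; rewrite coefM.
have aab : (a < (a + b).+1)%N by lia.
rewrite (bigD1 (Ordinal aab)) //= addKn big1 ?addr0 // => i /eqP/val_eqP /= ia.
have [ai|ai] := ltnP a i.
  by rewrite (nth_default _ (leq_trans sp ai)) mul0r.
rewrite [q`_ _]nth_default ?mulr0 //; apply: leq_trans sq _; move/eqP in ia; lia.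
Qed.

Lemma size_prod_le I (r : seq I) (p : I -> {poly rat}) (a : I -> nat) :
  (forall i, size (p i) <= (a i).+1)%N ->
  (size (\prod_(i <- r) p i)%R <= (\sum_(i <- r) a i).+1)%N.
Proof.
move=> sp; elim: r => [|i r IH]; first by rewrite !big_nil size_poly1.
rewrite !big_cons; apply: leq_trans (size_polyMleq _ _) _; have := sp i; lia.
Qed.

Lemma coef_prod_top I (r : seq I) (p : I -> {poly rat}) (a : I -> nat) :
  (forall i, size (p i) <= (a i).+1)%N ->
  (\prod_(i <- r) p i)`_(\sum_(i <- r) a i) = \prod_(i <- r) (p i)`_(a i).
Proof.
move=> sp; elim: r => [|i r IH]; first by rewrite !big_nil coef1.
by rewrite !big_cons coef_mul_top ?IH //; apply: size_prod_le.
Qed.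

Lemma coef_det_top n (M : 'M[{poly rat}]_n) (d : 'I_n -> nat) :
  (forall i j, size (M i j) <= (d j).+1)%N ->
  (size (\det M) <= (\sum_j d j).+1)%N /\
  (\det M)`_(\sum_j d j) = \det (\matrix_(i, j) (M i j)`_(d j)).
Proof.
move=> sM.
have perm_sum (s : 'S_n) : (\sum_i d (s i) = \sum_j d j)%N.
  by rewrite [RHS](reindex_inj (@perm_inj _ s)).
have sgnC (s : 'S_n) : (-1) ^+ s = ((-1) ^+ s)%:P :> {poly rat} by rewrite polyC_exp polyCN.
split.
  apply: leq_trans (size_sum _ _ _) _; apply/bigmax_leqP => s _.
  rewrite sgnC mul_polyC; apply: leq_trans (size_scale_leq _ _) _.
  by rewrite -(perm_sum s); apply: size_prod_le.
rewrite /determinant coef_sum; apply: eq_bigr => s _.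
rewrite sgnC mul_polyC coefZ -(perm_sum s) coef_prod_top //.
congr (_ * _); apply: eq_bigr => i _; by rewrite mxE.
Qed.

(* Subtracting Phi_j times column 0 from column j shows that 'X^(m N) divides det M; the
   degrees of the entries leave no room for a nonconstant cofactor. *)
Lemma pade_det_horner m N (M S : 'M[{poly rat}]_m.+1) (Q Phi : 'I_m.+1 -> {poly rat})
    (d : 'I_m.+1 -> nat) x :
  Phi ord0 = 1 -> (forall k, S k ord0 = 0) ->
  (forall k j, M k j = Q k * Phi j + S k j * 'X^N) ->
  (forall k j, size (M k j) <= d j + (k == j))%N ->
  (forall k, (M k k)`_(d k) != 0) ->
  (\sum_j d j = m * N)%N -> x != 0 ->
  \det (\matrix_(k, j) (M k j).[x]) != 0.
Proof.
move=> P0 S0 ME sM lead dN x0.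
have [sdet top] := @coef_det_top _ M d (fun k j => leq_trans (sM k j)
  (leq_trans (leq_add (leqnn _) (leq_b1 _)) (eq_leq (addn1 _)))).
have lead_det : (\det M)`_(m * N) != 0.
  rewrite -dN top; set L := matrix_of_fun _ _.
  (* Off the diagonal the size is at most [d j], so the coefficient of degree [d j] is zero. *)
  have -> : L = diag_mx (\row_j (M j j)`_(d j)).
    apply/matrixP => i j; rewrite !mxE; case: eqP => [->|/eqP nij]; first by rewrite mulr1n.
    by rewrite nth_default //; move: (sM i j); rewrite (negbTE nij) addn0.
  by rewrite det_diag; apply/prodf_neq0 => i _; rewrite mxE.
pose A : 'M[{poly rat}]_m.+1 := \matrix_(k, j) if j == ord0 then Q k else S k j.
pose U : 'M[{poly rat}]_m.+1 :=
  \matrix_(k, j) if k == ord0 then Phi j else ((k == j)%:R * 'X^N).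
have MAU : M = A *m U.
  apply/matrixP => k j; rewrite !mxE (bigD1 ord0) //= !mxE /= ME; congr (_ + _).
  have [->|j0] := eqVneq j ord0.
    rewrite S0 mul0r big1 // => i i0; rewrite !mxE (negbTE i0) mul0r mulr0 //.
  rewrite (bigD1 j) //= big1 ?addr0 => [|i /andP[i0 ij]].
    by rewrite !mxE (negbTE j0) eqxx mul1r.
  by rewrite !mxE (negbTE i0) (negbTE ij) mul0r mulr0.
have detU : \det U = 'X^(m * N).
  rewrite -det_tr det_trig; last first.
    apply/is_trig_mxP => i j ij; rewrite !mxE.
    have -> : (j == ord0) = false by apply/negbTE; rewrite -val_eqE /= -lt0n; apply: leq_ltn_trans ij.
    by rewrite -val_eqE /= gtn_eqF // mul0r.
  rewrite big_ord_recl !mxE eqxx P0 mul1r.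
  under eq_bigr => i _ do rewrite !mxE /= eqxx mul1r.
  by rewrite prodr_const card_ord -exprM mulnC.
have dE : \det M = \det A * 'X^(m * N) by rewrite MAU det_mulmx detU.
have A0 : (\det A)`_0 = (\det M)`_(m * N) by rewrite dE coefMXn ltnn subnn.
have sA : (size (\det A) <= 1)%N.
  apply/leq_sizeP => i i0; have : (\det M)`_(i + m * N) = 0.
    by apply/(leq_sizeP _ _ sdet); rewrite dN; lia.
  by rewrite dE coefMXn ltnNge leq_addl /= addnK.
have -> : \det (\matrix_(k, j) (M k j).[x]) = (\det M).[x].
  have -> : (\matrix_(k, j) (M k j).[x]) = map_mx (horner_eval x) M.
    by apply/matrixP => i j; rewrite !mxE.
  by rewrite det_map_mx.
rewrite dE (size1_polyC sA) hornerM hornerC hornerXn A0 mulf_neq0 //.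
by rewrite expf_neq0.
Qed.

Lemma det_neq0_row n (A : 'M[rat]_n) (l : 'I_n -> rat) : \det A != 0 ->
  (exists j, l j != 0) -> exists k, \sum_j A k j * l j != 0.
Proof.
move=> dA [j0 lj0]; apply/existsP; apply: contraT; rewrite negb_exists => /forallP H.
have E : A *m (\col_j l j) = 0.
  apply/matrixP => k z; rewrite !mxE; move: (H k); rewrite negbK => /eqP E0.
  by rewrite -[RHS]E0; apply: eq_bigr => j _; rewrite mxE.
have : \col_j l j = 0.
  have Au : A \in unitmx by rewrite unitmxE unitfE.
  by rewrite -[LHS](mulKmx Au) E mulmx0.
by move/matrixP/(_ j0 ord0); rewrite !mxE => /eqP; rewrite (negbTE lj0).
Qed.

Section PadeSystem.
Variables (m : nat) (al : nat -> rat) (n : nat -> nat) (T : nat).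
Let c := al 0%N.
Definition padeD := (\sum_(j < m) n j.+1)%N.
Definition padeN := (n 0%N + padeD)%N.
(* The zeros alpha_j + n_0 - k (k < n_j) are the arguments alpha_j + r attached by
   padeQPhi_coef to the coefficients of Q phi_j of degrees N - n_j + 1, ..., N. *)
Definition padeG : {poly rat} :=
  (padeD`!%:R / \prod_(j < m) (n j.+1)`!%:R) *:
  \prod_(j < m) risingP (- (al j.+1 + (n 0%N)%:R)) (n j.+1).
Definition padeq (i : nat) : rat := expcoef c padeD padeG i.
(** The order is reversed so that the coefficient of degree i of Q phi_j is the sum of the q_k
    h_(i-D+k), as in [expcoef_hcoef] with r = i - D. *)
Definition padeQ : {poly rat} := \poly_(i < padeD.+1) padeq (padeD - i).
(** With the constant 1 at index 0, l_0 is treated like the other coefficients and column 0 of the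
    Pade matrix is Q itself. *)
Definition padePhi (j : nat) : {poly rat} :=
  if j is 0%N then 1 else \poly_(r < T) hcoef c (al j) r.

Hypothesis al_gt0 : forall j, (j <= m)%N -> 0 < al j.
Hypothesis n_le : forall j, (j <= m)%N -> (n j <= n 0)%N.
Hypothesis NT : (padeN < T)%N.

Lemma padeNB j : (j <= m)%N -> (padeN - n j)%N = (n 0%N - n j + padeD)%N.
Proof. by move=> jm; rewrite /padeN addnBAC // n_le. Qed.

Lemma prod_fact_neq0 : \prod_(j < m) (n j.+1)`!%:R != 0 :> rat.
Proof. by apply/prodf_neq0 => j _; rewrite pnatr_eq0 -lt0n fact_gt0. Qed.

Lemma size_padeG : (size padeG <= padeD.+1)%N.
Proof.
apply: leq_trans (size_scale_leq _ _) _; rewrite /padeD.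
by apply: size_prod_le => j; rewrite size_risingP.
Qed.

Lemma padeG_horner x : padeG.[x] = (padeD`!%:R / \prod_(j < m) (n j.+1)`!%:R) *
  \prod_(j < m) rising (x - (al j.+1 + (n 0%N)%:R)) (n j.+1).
Proof.
by rewrite hornerZ horner_prod; congr (_ * _); apply: eq_bigr => j _; rewrite horner_risingP.
Qed.

Lemma padeG_eq0 x : (padeG.[x] == 0) =
  [exists j : 'I_m, rising (x - (al j.+1 + (n 0%N)%:R)) (n j.+1) == 0].
Proof.
rewrite padeG_horner mulf_eq0 (negbTE (mulf_neq0 _ (invr_neq0 prod_fact_neq0))) /=; last first.
  by rewrite pnatr_eq0 -lt0n fact_gt0.
apply/prodf_eq0/existsP => [[j _ E]|[j E]]; by exists j.
Qed.

(** [expcoef] sees G only at the points -k. Thanks to n_j <= n_0, reflection yields binomials at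
    positive arguments, whose sizes and denominators are under control. *)
Lemma padeG_nat k : padeG.[- k%:R] = padeD`!%:R * (-1) ^+ padeD *
  \prod_(j < m) mbin (al j.+1 + (n 0%N - n j.+1).+1%:R + k%:R) (n j.+1).
Proof.
rewrite padeG_horner /mbin prodf_div; have P0 := prod_fact_neq0.
have -> : \prod_(j < m) rising (- k%:R - (al j.+1 + (n 0%N)%:R)) (n j.+1) =
  \prod_(j < m) ((-1) ^+ n j.+1 * rising (al j.+1 + (n 0%N - n j.+1).+1%:R + k%:R) (n j.+1)).
  apply: eq_bigr => j _; have nj := n_le (ltn_ord j).
  have := rising_reflect ((n j.+1)%:R - k%:R - (al j.+1 + (n 0%N)%:R)) (n j.+1).
  have -> : (n j.+1)%:R - k%:R - (al j.+1 + (n 0)%:R) - (n j.+1)%:R =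
    - k%:R - (al j.+1 + (n 0)%:R) by ring.
  move=> ->; congr (_ * rising _ _); rewrite -natr1 natrB //; ring.
rewrite big_split /= prodrXr -/padeD.
by field.
Qed.

Lemma padeQPhi_coef j i : (0 < j <= m)%N -> (padeD <= i < T)%N ->
  (padeQ * padePhi j)`_i = rising (al j) (i - padeD) / rising (al j + c) i *
     padeG.[al j + (i - padeD)%:R].
Proof.
move=> /andP[j0 jm] /andP[Di iT].
have := @expcoef_hcoef c padeD padeG (al j) (i - padeD) (al_gt0 (leq0n m)) (al_gt0 jm) size_padeG.
rewrite subnK // => <-.
rewrite coefM -(big_mkord xpredT (fun k => padeQ`_k * (padePhi j)`_(i - k))).
rewrite (@big_cat_nat _ _ _ padeD.+1) //= [X in _ + X]big_nat [X in _ + X]big1 ?addr0; last first.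
  by move=> k /andP[Dk _]; rewrite coef_poly ltnNge Dk mul0r.
rewrite big_mkord (reindex_inj rev_ord_inj) /=; apply: eq_bigr => k _.
have kD := leq_ord k; rewrite !subSS coef_poly ltnS leq_subr subKn //; congr (_ * _).
case: j j0 jm => [//|j] _ jm; rewrite coef_poly; 
have -> : (i - (padeD - k) = i - padeD + k)%N by lia.
by rewrite (_ : (i - padeD + k < T)%N = true) //; apply/idP; lia.
Qed.

(** For j = 0 this is deg Q <= N - n_0. For j > 0, n_j <= n_0 forces i >= D, and alpha_j + i - D is
    the zero of the j-th factor of G with l = N - i. *)
Lemma padeQPhi_vanish j i : (j <= m)%N -> (padeN - n j < i <= padeN)%N ->
  (padeQ * padePhi j)`_i = 0.
Proof.
move=> jm; rewrite padeNB // => /andP[lo hi].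
case: j jm lo => [|j] jm lo.
  by rewrite mulr1 coef_poly ltnS leqNgt (_ : _ < i)%N // -(add0n padeD) -(subnn (n 0%N)).
rewrite padeQPhi_coef //; last by apply/andP; split; lia.
apply/eqP; rewrite mulf_eq0 padeG_eq0; apply/orP; right; apply/existsP; exists (Ordinal jm) => /=.
have hi2 : (padeN - i < n j.+1)%N by have := n_le jm; move: hi lo; rewrite /padeN; lia.
apply/prodf_eq0; exists (Ordinal hi2) => //=.
have -> : (n 0%N)%:R = (i - padeD)%:R + (padeN - i)%:R :> rat.
  by rewrite -natrD; congr (_%:R); move: hi lo; rewrite /padeN; lia.
by apply/eqP; ring.
Qed.

Hypothesis al_int : forall i j, (1 <= i <= m)%N -> (1 <= j <= m)%N -> i != j ->
  al i - al j \isn't a Num.int.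

(** For j = 0 the coefficient is a nonzero multiple of G(0), and all zeros of G are positive. For j
    > 0 the argument alpha_j + n_0 - n_j lies one below the zeros of the j-th factor; a zero of the
    i-th factor there would make alpha_j - alpha_i an integer. *)
Lemma padeQPhi_lead j : (j <= m)%N -> (padeQ * padePhi j)`_(padeN - n j) != 0.
Proof.
move=> jm; have c0 := al_gt0 (leq0n m); case: j jm => [|j] jm.
  rewrite mulr1 padeNB // subnn add0n coef_poly ltnSn subnn /padeq /expcoef big_ord1.
  rewrite !mbin0 expr0 mul1r mulr1 subn0 mul1r mulf_neq0 //; last first.
    by rewrite invr_eq0 gt_eqF // rising_gt0.
  rewrite padeG_eq0; apply/existsPn => j; apply: rising_neq0 => l ln.
  rewrite lt_eqF // oppr0 add0r addrC subr_lt0.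
  apply: le_lt_trans (ltr_pwDl (al_gt0 (ltn_ord j)) (lexx _)).
  by rewrite ler_nat; apply: leq_trans (n_le (ltn_ord j)); apply: ltnW.
have nj := n_le jm.
rewrite padeQPhi_coef //; last first.
  by rewrite padeNB // leq_addl /= -padeNB //; apply: leq_ltn_trans NT; apply: leq_subr.
rewrite padeNB // addnK.
have alj := al_gt0 jm.
apply: mulf_neq0; first by rewrite gt_eqF // divr_gt0 // rising_gt0 // addr_gt0.
rewrite padeG_eq0; apply/existsPn => i; apply: rising_neq0 => l ln.
have [ij|ij] := eqVneq (i : nat) j.
  move: ln; rewrite ij => ln; rewrite natrB //.
  have -> : al j.+1 + ((n 0%N)%:R - (n j.+1)%:R) - (al j.+1 + (n 0%N)%:R) + l%:R =
    l%:R - (n j.+1)%:R by ring.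
  by rewrite subr_eq0 eqr_nat ltn_eqF.
apply: contraNneq (al_int (i := j.+1) (j := i.+1) jm (ltn_ord i) _) => [E|]; last first.
  by rewrite eqSS eq_sym.
have -> : al j.+1 - al i.+1 = (n 0%N)%:R - l%:R - (n 0%N - n j.+1)%:R.
  by apply/eqP; rewrite -subr_eq0 -E; apply/eqP; ring.
by rewrite !rpredB ?natr_int.
Qed.
End PadeSystem.

(** By [fact_div_rising] the reciprocal is r times an iterated difference of the numbers v/(u + l
    v), so an lcm suffices; clearing the product of the u + l v would cost factorial growth. *)
Lemma lcmto_div_mbin_int (u v r B : nat) : (0 < u)%N -> (0 < v)%N -> (u + r * v <= B)%N ->
  (lcmto B)%:R / mbin (u%:R / v%:R) r \is a Num.int.
Proof.
move=> u0 v0; case: r => [|r] uB; first by rewrite mbin0 divr1 natr_int.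
have v_neq0 : v%:R != 0 :> rat by rewrite pnatr_eq0 -lt0n.
have pos l : u%:R / v%:R + l%:R = (u + l * v)%:R / v%:R :> rat.
  by rewrite natrD natrM; field.
have nz l : u%:R / v%:R + l%:R != 0 :> rat.
  by rewrite pos mulf_neq0 ?invr_eq0 // pnatr_eq0 -lt0n addn_gt0 u0.
have H := @fact_div_rising (fun x => x \is a Num.int) (lcmto B)%:R
   (fun x y hx hy => rpredB hx hy) r (u%:R / v%:R) (fun l _ => nz l).
have -> : (lcmto B)%:R / mbin (u%:R / v%:R) r.+1 =
   r.+1%:R * ((lcmto B)%:R * r`!%:R / rising (u%:R / v%:R) r.+1).
  by rewrite /mbin invf_div factS natrM; ring.
rewrite rpredM ?natr_int //; apply: H => l lr.
have /dvdnP[w ->] : (u + l * v %| lcmto B)%N.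
  apply: dvdn_lcmto; rewrite addn_gt0 u0 /=; apply: leq_trans uB; rewrite leq_add2l leq_mul2r.
  by rewrite (leqW lr) orbT.
rewrite pos invf_div natrM mulrA mulrAC mulfK; first by rewrite rpredM ?natr_int.
by rewrite pnatr_eq0 -lt0n addn_gt0 u0.
Qed.

Lemma hcoef_mbin c x r : 0 < c -> 0 < x -> hcoef c x r = mbin x r / mbin (x + c) r.
Proof.
move=> c0 x0; rewrite /hcoef /mbin.
have f0 : r`!%:R != 0 :> rat by rewrite pnatr_eq0 -lt0n fact_gt0.
by field; rewrite f0 gt_eqF // rising_gt0 // addr_gt0.
Qed.

Lemma hcoef_norm c x r : 0 < c -> 0 < x -> `|hcoef c x r| <= 1.
Proof.
move=> c0 x0; rewrite ger0_norm.
  rewrite ler_pdivrMr ?rising_gt0 ?addr_gt0 // mul1r.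
  apply: ler_prod => i _; rewrite lerD2r lerDl (ltW c0) andbT.
  by apply: addr_ge0 => //; apply: ltW.
by rewrite divr_ge0 // ltW // rising_gt0 // addr_gt0.
Qed.

(** * Sizes and common denominators of the approximants *)

Section Bounds.
Variables (m v A : nat) (u n : nat -> nat) (T : nat).
Hypothesis v0 : (0 < v)%N.
Hypothesis u0 : forall j, (j <= m)%N -> (0 < u j <= A)%N.
Hypothesis n_le : forall j, (j <= m)%N -> (n j <= n 0)%N.

Definition alq (j : nat) : rat := (u j)%:R / v%:R.
Local Notation al := alq.
Local Notation c := (al 0%N).
Local Notation D := (padeD m n).
Local Notation N := (padeN m n).
Local Notation q := (padeq m al n).

Lemma vq_gt0 : 0 < v%:R :> rat. Proof. by rewrite ltr0n. Qed.

Lemma alq_gt0 j : (j <= m)%N -> 0 < al j.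
Proof. by move=> /u0 /andP[uj _]; rewrite divr_gt0 ?ltr0n. Qed.

Lemma alq_le j : (j <= m)%N -> al j <= A%:R.
Proof.
move=> /u0 /andP[_ uA]; rewrite ler_pdivrMr ?vq_gt0 // -natrM ler_nat.
by apply: leq_trans uA _; rewrite leq_pmulr.
Qed.

(** This explains the normalisation of [padeG]: D! against k! (c)_(D-k) leaves binomial(D,k) /
    [mbin c (D - k)], and each n_j! completes a binomial. *)
Lemma padeq_termE k r : (k <= D)%N ->
  (-1) ^+ k * ((padeG m al n).[- k%:R] / (k`!%:R * rising c (D - k))) * mbin (c - 1) r =
  (-1) ^+ (k + D) * (\prod_(j < m) mbin (al j.+1 + (n 0%N - n j.+1).+1%:R + k%:R) (n j.+1) *
   'C(D, k)%:R / mbin c (D - k) * mbin (c - 1) r).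
Proof.
move=> kD; rewrite padeG_nat // exprD -(bin_fact kD) !natrM /mbin.
have f0 (i : nat) : i`!%:R != 0 :> rat by rewrite pnatr_eq0 -lt0n fact_gt0.
have c0 := alq_gt0 (leq0n m).
by field; rewrite !f0 gt_eqF // rising_gt0.
Qed.

(** In [Cq], the factors 2^m, 2, v+1 and A+2 bound the product of binomials, binomial(D,k),
    1/[mbin c] and [mbin (c - 1)]; a further 2 pays for the at most 2^N summands. [Kq] collects the
    shift A+1 of the m binomials. *)
Definition Kq : nat := (2 ^ (A.+1 * m))%N.
Definition Cq : nat := (4 * 2 ^ m * v.+1 * A.+2)%N.

Lemma padeq_term_le k r : (k <= D)%N -> (r <= N)%N ->
  `|(-1) ^+ k * ((padeG m al n).[- k%:R] / (k`!%:R * rising c (D - k))) * mbin (c - 1) r|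
  <= (Kq * (2 * 2 ^ m * v.+1 * A.+2) ^ N)%:R.
Proof.
move=> kD rN; have c0 := alq_gt0 (leq0n m); have DN : (D <= N)%N by apply: leq_addl.
have normE (x y z t : rat) : `|x * y / z * t| = `|x| * `|y| * `|z^-1| * `|t| by rewrite !normrM.
rewrite padeq_termE // normrMsign normE.
have pw (x : rat) i : 1 <= x -> (i <= N)%N -> x ^+ i <= x ^+ N by move=> *; apply: ler_weXn2l.
have h1 : `|\prod_(j < m) mbin (al j.+1 + (n 0%N - n j.+1).+1%:R + k%:R) (n j.+1)|
   <= (2 ^ (A.+1 * m) * (2 ^ m) ^ N)%:R.
  rewrite normr_prod -expnM -expnD -mulnC [(m * N)%N]mulnC.
  rewrite [(m * A.+1)%N]mulnC -mulnDl expnM natrX.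
  rewrite -[X in _ <= _ ^+ X](card_ord m) -prodr_const; apply: ler_prod => j _; rewrite normr_ge0 /=.
  have alj := alq_gt0 (ltn_ord j); have njm := n_le (ltn_ord j).
  rewrite ger0_norm; last first.
    by apply: mbin_ge0; do 2![apply: addr_ge0 => //]; apply: ltW.
  apply: le_trans (mbin_mono (y := (A + (n 0%N - n j.+1).+1 + k)%:R) _ _) _.
    rewrite !natrD !lerD2r alq_le // andbT; do 2![apply: addr_ge0 => //]; exact: ltW.
  apply: le_trans (mbin_nat_le _ _) _; rewrite natrX ler_weXn2l ?ler1n //.
  by rewrite /padeN; lia.
have h2 : `|'C(D, k)%:R| <= (2 ^ N)%:R :> rat.
  rewrite ger0_norm ?ler0n // ler_nat; apply: leq_trans (bin_leq_exp2 _ _) _.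
  by rewrite leq_pexp2l.
have h3 : `|(mbin c (D - k))^-1| <= (v.+1 ^ N)%:R.
  rewrite ger0_norm; last by rewrite invr_ge0 mbin_ge0 // ltW.
  apply: le_trans (mbin_inv_le (B := v%:R) (D - k) c0 _) _.
    rewrite invf_div ler_pdivrMr ?ltr0n; last by have /andP[] := u0 (leq0n m).
    by rewrite -natrM ler_nat leq_pmulr //; have /andP[] := u0 (leq0n m).
  rewrite natr1 natrX; apply: pw; first by rewrite ler1n.
  by apply: leq_trans DN; apply: leq_subr.
have h4 : `|mbin (c - 1) r| <= (A.+2 ^ N)%:R.
  apply: le_trans (mbin_norm_le (A := A.+1%:R) _ _) _.
    apply: le_trans (ler_normB _ _) _; rewrite normr1 -natr1 lerD2r.
    by rewrite gtr0_norm // alq_le.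
  by rewrite natr1 natrX; apply: pw => //; rewrite ler1n.
have -> : (Kq * (2 * 2 ^ m * v.+1 * A.+2) ^ N)%N =
  (2 ^ (A.+1 * m) * (2 ^ m) ^ N * 2 ^ N * v.+1 ^ N * A.+2 ^ N)%N.
  by rewrite /Kq !expnMn; lia.
rewrite [X in _ <= X]natrM; apply: ler_pM; rewrite ?mulr_ge0 ?normr_ge0 //.
rewrite [X in _ <= X]natrM; apply: ler_pM; rewrite ?mulr_ge0 ?normr_ge0 //.
by rewrite [X in _ <= X]natrM; apply: ler_pM.
Qed.

Lemma padeq_le i : (i <= D)%N -> `|q i| <= (Kq * Cq ^ N)%:R.
Proof.
move=> iD; have DN : (D <= N)%N by apply: leq_addl.
apply: le_trans (ler_norm_sum _ _ _) _.
apply: (@le_trans _ _ (\sum_(k < i.+1) (Kq * (2 * 2 ^ m * v.+1 * A.+2) ^ N)%:R)).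
  apply: ler_sum => k _; apply: padeq_term_le.
    exact: leq_trans (leq_ord k) iD.
  by apply: leq_trans (leq_subr _ _) _; apply: leq_trans iD DN.
rewrite sumr_const card_ord -[_ *+ i.+1]mulr_natr -natrM ler_nat.
have -> : Cq = (2 * (2 * 2 ^ m * v.+1 * A.+2))%N by rewrite /Cq; lia.
have i1 : (i.+1 <= 2 ^ N)%N.
  by apply: leq_trans (_ : N.+1 <= _)%N; [lia | apply: ltn_expl].
set Y := (2 * 2 ^ m * v.+1 * A.+2)%N.
by rewrite expnMn -mulnA leq_mul2l [X in (X <= _)%N]mulnC leq_mul2r i1 !orbT.
Qed.

(** The range covers u_0 + r v and u_j + u_0 + r v for r <= N, so one lcm serves both Q and the
    phi_j. *)
Definition lcmB : nat := lcmto (A + A + N * v).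

Lemma padeq_int i : (i <= D)%N -> v%:R ^+ (4 * N) * lcmB%:R * q i \is a Num.int.
Proof.
move=> iD; have DN : (D <= N)%N by apply: leq_addl.
rewrite mulr_sumr rpred_sum // => k _.
have kD : (k <= D)%N by apply: leq_trans (leq_ord k) iD.
rewrite padeq_termE // mulrCA rpredM ?rpredX ?rpredN1 //.
(* The part 2D clears the product of binomials and 2(i-k) clears [mbin (c - 1)]; the rest only makes
   the exponent uniform. *)
have -> : (4 * N = 2 * (2 * N - D - (i - k)) + 2 * D + 2 * (i - k))%N by have := leq_ord k; lia.
rewrite 2!exprD; set P := \prod_(_ < _) _; set B := 'C(_, _)%:R.
have -> : v%:R ^+ (2 * (2 * N - D - (i - k))) * v%:R ^+ (2 * D) * v%:R ^+ (2 * (i - k)) *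
  lcmB%:R * (P * B / mbin c (D - k) * mbin (c - 1) (i - k)) =
  v%:R ^+ (2 * (2 * N - D - (i - k))) * B * (v%:R ^+ (2 * D) * P) *
  (lcmB%:R / mbin c (D - k)) * (v%:R ^+ (2 * (i - k)) * mbin (c - 1) (i - k)) by ring.
have v_neq0 : v%:R != 0 :> rat by rewrite pnatr_eq0 -lt0n.
apply: rpredM; [apply: rpredM; [apply: rpredM|]|].
- by rewrite rpredM ?rpredX ?natr_int.
- have -> : v%:R ^+ (2 * D) = \prod_(j < m) v%:R ^+ (2 * n j.+1) :> rat.
    by rewrite prodrXr /padeD big_distrr.
  rewrite -big_split rpred_prod // => j _.
  have -> : al j.+1 + (n 0%N - n j.+1).+1%:R + k%:R =
    (u j.+1 + ((n 0%N - n j.+1).+1 + k) * v)%N%:Z%:~R / v%:R.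
    by rewrite -pmulrn natrD natrM natrD /al; field.
  exact: mbin_int.
- have /andP[u00 uA] := u0 (leq0n m); apply: lcmto_div_mbin_int => //.
  have h : ((D - k) * v <= N * v)%N by rewrite leq_mul2r (leq_trans (leq_subr _ _) DN) orbT.
  lia.
have -> : c - 1 = ((u 0%N)%:Z - v%:Z)%:~R / v%:R by rewrite intrB -!pmulrn /al; field.
exact: mbin_int.
Qed.

Lemma hcoef_int j r : (0 < j <= m)%N -> (r <= N)%N ->
  v%:R ^+ (2 * N) * lcmB%:R * hcoef c (al j) r \is a Num.int.
Proof.
move=> /andP[j0 jm] rN; rewrite hcoef_mbin ?alq_gt0 //.
have -> : (2 * N = 2 * (N - r) + 2 * r)%N by lia.
rewrite exprD.
have -> : al j + c = (u j + u 0%N)%:R / v%:R by rewrite natrD mulrDl.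
set w := _%:R / _.
have -> : v%:R ^+ (2 * (N - r)) * v%:R ^+ (2 * r) * lcmB%:R * (mbin (al j) r / mbin w r) =
  v%:R ^+ (2 * (N - r)) * (v%:R ^+ (2 * r) * mbin (al j) r) * (lcmB%:R / mbin w r) by ring.
have /andP[u00 uA] := u0 (leq0n m); have /andP[uj0 ujA] := u0 jm.
apply: rpredM; [apply: rpredM|].
- by rewrite rpredX ?natr_int.
- rewrite /al -[(u j)%:R]/(((u j)%:Z)%:~R); exact: mbin_int.
apply: lcmto_div_mbin_int => //; first by rewrite addn_gt0 u00 orbT.
have h : (r * v <= N * v)%N by rewrite leq_mul2r rN orbT.
lia.
Qed.

Local Notation Q := (padeQ m al n).
Local Notation Phi := (padePhi al T).
Definition padeDelta : nat := (v ^ (6 * N) * lcmB ^ 2)%N.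

Lemma padeQ_int i : v%:R ^+ (4 * N) * lcmB%:R * Q`_i \is a Num.int.
Proof.
rewrite coef_poly; case: ifP => [iD|_]; last by rewrite mulr0.
by rewrite padeq_int ?leq_subr.
Qed.

Lemma padeDelta_Q_int i : padeDelta%:R * Q`_i \is a Num.int.
Proof.
have -> : padeDelta%:R * Q`_i = (v ^ (2 * N) * lcmB)%:R * (v%:R ^+ (4 * N) * lcmB%:R * Q`_i).
  rewrite /padeDelta (_ : 6 * N = 2 * N + 4 * N)%N; last by lia.
  by rewrite expnD !natrM !natrX; ring.
by rewrite rpredM ?natr_int // padeQ_int.
Qed.

Lemma padeDelta_QPhi_int j i : (j <= m)%N -> (i <= N)%N ->
  padeDelta%:R * (Q * Phi j)`_i \is a Num.int.
Proof.
case: j => [|j] jm iN; first by rewrite mulr1 padeDelta_Q_int.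
rewrite coefM mulr_sumr rpred_sum // => k _; rewrite [(padePhi _ _ _)`_(_)]coef_poly.
case: ifP => _; last by rewrite !mulr0.
have -> : padeDelta%:R * (Q`_k * hcoef c (al j.+1) (i - k)) =
  (v%:R ^+ (4 * N) * lcmB%:R * Q`_k) * (v%:R ^+ (2 * N) * lcmB%:R * hcoef c (al j.+1) (i - k)).
  rewrite /padeDelta (_ : 6 * N = 4 * N + 2 * N)%N; last by lia.
  by rewrite expnD !natrM !natrX; ring.
rewrite rpredM ?padeQ_int ?hcoef_int //.
exact: leq_trans (leq_subr _ _) iN.
Qed.

Lemma padeQPhi_norm j i : (j <= m)%N -> (i <= N)%N ->
  `|(Q * Phi j)`_i| <= (Kq * (2 * Cq) ^ N)%:R.
Proof.
move=> jm iN; rewrite coefM; apply: le_trans (ler_norm_sum _ _ _) _.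
apply: (@le_trans _ _ (\sum_(k < i.+1) (Kq * Cq ^ N)%:R)).
  apply: ler_sum => k _; rewrite normrM -[X in _ <= X]mulr1.
  apply: ler_pM; rewrite ?normr_ge0 //.
    rewrite coef_poly; case: ifP => _; last by rewrite normr0.
    by apply: padeq_le; apply: leq_subr.
  case: j jm => [|j] jm /=; first by rewrite coef1; case: eqP; rewrite ?normr1 ?normr0.
  rewrite coef_poly; case: ifP => _; last by rewrite normr0.
  by apply: hcoef_norm; rewrite alq_gt0.
rewrite sumr_const card_ord -[_ *+ i.+1]mulr_natr -natrM ler_nat expnMn.
have i1 : (i.+1 <= 2 ^ N)%N.
  by apply: leq_trans (_ : N.+1 <= _)%N; [lia | apply: ltn_expl].
by rewrite -mulnA leq_mul2l [X in (X <= _)%N]mulnC leq_mul2r i1 !orbT.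
Qed.

Lemma padeDelta_le : (padeDelta <= 256 ^ (A + A) * (v ^ 6 * 256 ^ v) ^ N)%N.
Proof.
rewrite /padeDelta /lcmB expnMn -!expnM mulnCA leq_mul2l; apply/orP; right.
apply: leq_trans (_ : (16 ^ (A + A + N * v)) ^ 2 <= _)%N.
  by rewrite leq_exp2r // lcmto_leq.
by rewrite -expnM mulnC expnM -expnD [(v * N)%N]mulnC.
Qed.
End Bounds.

(** * p-adic estimates *)

(* The p-adic valuation of x is at least e; in particular this holds for x = 0. *)
Definition vge (p e : nat) (x : rat) : Prop :=
  exists (y : int) (k : nat), ~~ (p %| k)%N /\ x * k%:R = (p ^ e)%:R * y%:~R.

Section Vge.
Variable p : nat.
Hypothesis pp : prime p.

Lemma ndvd_gt0 k : ~~ (p %| k)%N -> (0 < k)%N.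
Proof. by case: k => //; rewrite dvdn0. Qed.

Lemma ndvd_neq0 k : ~~ (p %| k)%N -> k%:R != 0 :> rat.
Proof. by move/ndvd_gt0; rewrite pnatr_eq0 -lt0n. Qed.

Lemma pexp_neq0 e : (p ^ e)%:R != 0 :> rat.
Proof. by rewrite pnatr_eq0 -lt0n expn_gt0 prime_gt0. Qed.

Lemma vgeM e f x y : vge p e x -> vge p f y -> vge p (e + f) (x * y).
Proof.
move=> [z [k [pk E]]] [z' [k' [pk' E']]]; exists (z * z'), (k * k')%N; split.
  by rewrite Euclid_dvdM // negb_or pk.
by rewrite natrM mulrACA E E' expnD natrM intrM; ring.
Qed.

Lemma vgeD e x y : vge p e x -> vge p e y -> vge p e (x + y).
Proof.
move=> [z [k [pk E]]] [z' [k' [pk' E']]]; exists (z * k'%:Z + z' * k%:Z), (k * k')%N; split.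
  by rewrite Euclid_dvdM // negb_or pk.
rewrite natrM intrD !intrM -!pmulrn mulrDr mulrDl.
have -> : x * (k%:R * k'%:R) = x * k%:R * k'%:R by ring.
have -> : y * (k%:R * k'%:R) = y * k'%:R * k%:R by ring.
by rewrite E E'; ring.
Qed.

Lemma vge_int e (z : int) : vge p e ((p ^ e)%:R * z%:~R).
Proof. by exists z, 1%N; rewrite dvdn1 mulr1; split=> //; case: p pp => [|[|[]]]. Qed.

Lemma vge0_int x : x \is a Num.int -> vge p 0 x.
Proof. by move/intrP => [z ->]; rewrite -[z%:~R]mul1r -[1](_ : (p ^ 0)%:R = _) //; apply: vge_int. Qed.

Lemma vge_zero e : vge p e 0.
Proof. by have := vge_int e 0; rewrite mulr0. Qed.

Lemma vge_sum e I (r : seq I) (P : pred I) (F : I -> rat) :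
  (forall i, P i -> vge p e (F i)) -> vge p e (\sum_(i <- r | P i) F i).
Proof. by move=> H; elim/big_ind: _ => //; [apply: vge_zero | apply: vgeD]. Qed.

Lemma vgeN e x : vge p e x -> vge p e (- x).
Proof.
by move=> h; rewrite -mulN1r -[e]add0n; apply: vgeM => //; apply: vge0_int; rewrite rpredN1.
Qed.

Lemma vgeB e x y : vge p e x -> vge p e y -> vge p e (x - y).
Proof. by move=> hx hy; apply: vgeD => //; apply: vgeN. Qed.

Lemma vge0M e x y : vge p 0 x -> vge p e y -> vge p e (x * y).
Proof. exact: vgeM. Qed.

Lemma vgeW e f x : (f <= e)%N -> vge p e x -> vge p f x.
Proof.
move=> fe [z [k [pk E]]]; exists ((p ^ (e - f))%:Z * z), k; split=> //.
by rewrite E intrM -pmulrn mulrA -natrM -expnD subnKC.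
Qed.

Lemma vge_inv k : ~~ (p %| k)%N -> vge p 0 k%:R^-1.
Proof. by move=> pk; exists 1, k; rewrite mulVf ?ndvd_neq0 // mulr1. Qed.

Lemma vgeX e x i : vge p e x -> vge p (e * i) (x ^+ i).
Proof.
move=> h; elim: i => [|i IH]; first by rewrite muln0 expr0; apply: vge0_int.
by rewrite mulnS exprS; apply: vgeM.
Qed.

Lemma vge_cancel e f x : vge p (e + f) ((p ^ f)%:R * x) -> vge p e x.
Proof.
move=> [z [k [pk E]]]; exists z, k; split=> //; apply: (mulfI (pexp_neq0 f)).
by rewrite mulrA E expnD natrM; ring.
Qed.

(** The link between p-adic and archimedean size, applied at the end to the nonzero integer Z. *)
Lemma vge_intP e (z : int) : vge p e z%:~R -> z != 0 -> (p ^ e <= absz z)%N.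
Proof.
move=> [y [k [pk E]]] z0; apply: dvdn_leq; first by rewrite absz_gt0.
have : (absz z * k = p ^ e * absz y)%N.
  have /intr_inj : (z * k%:Z)%:~R = ((p ^ e)%:Z * y)%:~R :> rat by rewrite !intrM -!pmulrn.
  by move/(congr1 absz); rewrite !abszM.
move=> H; rewrite -(@Gauss_dvdl _ _ k); first by rewrite H dvdn_mulr.
by rewrite coprimeXl // prime_coprime.
Qed.

Lemma vge_natr k : (0 < k)%N -> vge p (logn p k) k%:R.
Proof.
move=> k0; have := vge_int (logn p k) (k %/ p ^ logn p k)%N%:Z.
by rewrite -pmulrn -natrM mulnC divnK // pfactor_dvdnn.
Qed.

Lemma vge_intr (a : int) : a != 0 -> vge p (logn p (absz a)) a%:~R.
Proof.
move=> a0; rewrite [a]intEsign intrM rmorph_sign; apply: vge0M.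
  by apply: vge0_int; rewrite rpredX // rpredN1.
by rewrite -pmulrn abszMsign absz_nat; apply: vge_natr; rewrite absz_gt0.
Qed.

Lemma vge_pexp_div E k : (0 < k)%N -> (logn p k <= E)%N -> vge p 0 ((p ^ E)%:R / k%:R).
Proof.
move=> k0 kE; pose e := logn p k; pose k' := (k %/ p ^ e)%N.
have kk : k = (k' * p ^ e)%N by rewrite divnK // pfactor_dvdnn.
have k'p : ~~ (p %| k')%N.
  apply/negP => /dvdnP[w kw]; have : (p ^ e.+1 %| k)%N by rewrite kk kw -mulnA -expnS dvdn_mull.
  by rewrite pfactor_dvdn // ltnn.
have -> : (p ^ E)%:R / k%:R = (p ^ (E - e))%:R * k'%:R^-1 :> rat.
  rewrite kk -{1}(subnK kE) expnD !natrM.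
  by field; rewrite pexp_neq0 ndvd_neq0.
by apply: vge0M; [apply: vge0_int; rewrite natr_int | apply: vge_inv].
Qed.

(** The local counterpart of [lcmto_div_mbin_int]: the loss is the largest valuation among the u + l
    v, not their sum, hence logarithmic in n. *)
Lemma vge_mbin_inv u v n E : (0 < u)%N -> (0 < v)%N ->
  (forall l, (l < n)%N -> (logn p (u + l * v) <= E)%N) ->
  vge p 0 ((p ^ E)%:R / mbin (u%:R / v%:R) n).
Proof.
move=> u0 v0; case: n => [|n] H; first by rewrite mbin0 divr1; apply: vge0_int; rewrite natr_int.
have v_neq0 : v%:R != 0 :> rat by rewrite pnatr_eq0 -lt0n.
have pos l : u%:R / v%:R + l%:R = (u + l * v)%:R / v%:R :> rat.
  by rewrite natrD natrM; field.
have nz l : u%:R / v%:R + l%:R != 0 :> rat.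
  by rewrite pos mulf_neq0 ?invr_eq0 // pnatr_eq0 -lt0n addn_gt0 u0.
have -> : (p ^ E)%:R / mbin (u%:R / v%:R) n.+1 =
   n.+1%:R * ((p ^ E)%:R * n`!%:R / rising (u%:R / v%:R) n.+1).
  by rewrite /mbin invf_div factS natrM; ring.
apply: vge0M; first by apply: vge0_int; rewrite natr_int.
apply: (fact_div_rising (S := vge p 0)) => //; first exact: vgeB.
move=> l ln; rewrite pos invf_div mulrCA; apply: vge0M; first by apply: vge0_int; rewrite natr_int.
by apply: vge_pexp_div; rewrite ?addn_gt0 ?u0 // H.
Qed.

(* p^(mval s n) clears the p-part of the denominator of mbin (t / s) n. *)
Definition mval (s n : nat) : nat :=
  (logn p s * n + if (p %| s)%N then logn p n`! else 0)%N.

(** If p does not divide s, then s is a p-adic unit and [mbin_int] applies; otherwise s^n and n! are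
    cleared separately. *)
Lemma vge_mbin t s n : (0 < s)%N -> vge p 0 ((p ^ mval s n)%:R * mbin (t%:R / s%:R) n).
Proof.
move=> s0; rewrite /mval; case: ifP => ps; last first.
  have -> : logn p s = 0%N by apply/eqP; rewrite eqn0Ngt logn_gt0 mem_primes s0 ps !andbF.
  rewrite expn0 mul1r.
  have -> : mbin (t%:R / s%:R) n = (s ^ (2 * n))%:R^-1 * (s%:R ^+ (2 * n) * mbin (t%:R / s%:R) n).
    by rewrite natrX mulrA mulVf ?mul1r // expf_neq0 // pnatr_eq0 -lt0n.
  apply: vge0M; last by apply: vge0_int; apply: (mbin_int t%:Z).
  by apply: vge_inv; rewrite Euclid_dvdX // ps.
have s_neq0 : s%:R != 0 :> rat by rewrite pnatr_eq0 -lt0n.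
have -> : mbin (t%:R / s%:R) n = (\prod_(l < n) (t + l * s)%N)%N%:R / (s ^ n)%:R / n`!%:R.
  rewrite /mbin /rising; congr (_ / _); rewrite natrX natr_prod.
  have -> : s%:R ^+ n = \prod_(l < n) (s%:R : rat) by rewrite prodr_const card_ord.
  rewrite -prodf_div; apply: eq_bigr => l _; rewrite natrD natrM; by field.
rewrite expnD natrM.
set P := (\prod_(l < n) _)%N.
have -> : (p ^ (logn p s * n))%:R * (p ^ logn p n`!)%:R * (P%:R / (s ^ n)%:R / n`!%:R) =
  P%:R * ((p ^ (logn p s * n))%:R / (s ^ n)%:R) * ((p ^ logn p n`!)%:R / n`!%:R) :> rat by ring.
apply: vge0M; last by apply: vge_pexp_div; rewrite ?fact_gt0.
apply: vge0M; first by apply: vge0_int; rewrite natr_int.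
by apply: vge_pexp_div; rewrite ?expn_gt0 ?s0 // lognX mulnC.
Qed.

Lemma mval_mono s i r : (r <= i)%N -> (mval s r <= mval s i)%N.
Proof.
move=> ri; apply: leq_add; first by rewrite leq_mul2l ri orbT.
case: ifP => // _; apply: dvdn_leq_log => //; first exact: fact_gt0.
by rewrite -(bin_fact ri) dvdn_mull // dvdn_mulr.
Qed.

(** Let S = v_p(s) > 0; the loss is at most S(N+t) + (N+t)/(p-1). For odd p, g >= S+1 leaves t -
    t/2; for p = 2 the factorial can cost almost N+t, so g >= S+2 is required, which is the origin
    of delta(2,p). The second S N absorbs N/(p-1). The surplus t/2 is kept for the logarithmic
    loss. *)
Lemma mval_bound s g t N : (0 < s)%N -> (logn p s < g)%N ->
  (p = 2 -> 2 %| s -> (logn p s).+1 < g)%N ->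
  (mval s (N + t) + t./2 <= g * t + 2 * (logn p s * N))%N.
Proof.
move=> s0 sg s2; rewrite /mval; case: ifP => ps; last first.
  have -> : logn p s = 0%N by apply/eqP; rewrite eqn0Ngt logn_gt0 mem_primes s0 ps !andbF.
  have : (t <= g * t)%N by apply: leq_pmull; lia.
  lia.
have sig : (0 < logn p s)%N by rewrite logn_gt0 mem_primes pp s0 ps.
have := logn_fact_le (N + t) pp; move: (logn p _`!) => tau.
have [p2|p2] := eqVneq p 2%N.
  rewrite {1}p2 mul1n => tauN; have := s2 p2; rewrite -{1}p2 => /(_ ps).
  move: (logn p s) sig => S sig Sg.
  have := leq_mul (leqnn t) Sg; have := leq_mul sig (leqnn N).
  rewrite !mulnDr mul1n !mulnS; lia.
move=> tauN.
have p3 : (2 <= p.-1)%N by have := prime_gt1 pp; move/eqP: p2; lia.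
have := leq_trans (leq_mul p3 (leqnn tau)) tauN.
move: (logn p s) sig sg => S sig Sg.
have := leq_mul (leqnn t) Sg; have := leq_mul sig (leqnn N).
rewrite !mulnDr mul1n !mulnS; lia.
Qed.

Lemma leq_double_exp_half t : (t.+1 <= 2 * 2 ^ t./2)%N.
Proof.
have := ltn_expl t./2 (ltnSn 1); lia.
Qed.

Lemma affine_leq_mul x v N k : (x + (N + k) * v <= (x + v) * (N.+1 * k.+1))%N.
Proof.
have M1 : (N + k < N.+1 * k.+1)%N by rewrite mulSn mulnS; lia.
rewrite [X in (_ <= X)%N]mulnDl; apply: leq_add; first by apply: leq_pmulr; lia.
by rewrite mulnC leq_mul2l (ltnW M1) orbT.
Qed.

(* With i = N + t, the loss U + i v <= 2 (U + v) (N + 1) 2^(t/2) is covered by the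
   valuation t/2 left over in mval_bound. *)
Lemma vge_hcoef_tail (u0 u v t s : nat) (a : int) w N i r :
  (0 < u0)%N -> (0 < u)%N -> (0 < v)%N -> (0 < s)%N ->
  u%:R / v%:R = t%:R / s%:R :> rat -> a != 0 ->
  (logn p s < logn p (absz a))%N ->
  (p = 2 -> 2 %| s -> (logn p s).+1 < logn p (absz a))%N ->
  (p ^ w * (s ^ (2 * N) * (2 * (u + u0 + v) * N.+1)) <= p ^ (logn p (absz a) * N))%N ->
  (N <= i)%N -> (r <= i)%N ->
  vge p w (hcoef (u0%:R / v%:R) (u%:R / v%:R) r * a%:~R ^+ i).
Proof.
move=> u00 ugt0 v0 s0 ut a0 sg s2 hw Ni ri; set g := logn p (absz a).
have q0 k : (0 < k)%N -> 0 < k%:R / v%:R :> rat by move=> k0; rewrite divr_gt0 ?ltr0n.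
rewrite hcoef_mbin ?q0 //.
have -> : u%:R / v%:R + u0%:R / v%:R = (u + u0)%:R / v%:R :> rat by rewrite natrD mulrDl.
pose B := (u + u0 + i * v)%N; have B0 : (0 < B)%N by rewrite /B; lia.
(* [E] bounds the valuation of each u + u0 + l v with l < r, as these numbers are at most [B]. *)
pose E := trunc_log p B; have pE : (p ^ E <= B)%N by apply: trunc_logP => //; apply: prime_gt1.
have key : (w + (mval s r + E) <= g * i)%N.
  pose k := (i - N)%N; have ik : i = (N + k)%N by rewrite /k subnKC.
  suff H : (w + 2 * (logn p s * N) + E <= g * N + k./2)%N.
    have := mval_mono s ri; have := mval_bound k N s0 sg s2; rewrite -ik.
    have -> : (g * i = g * N + g * k)%N by rewrite ik mulnDr.
    move: H; rewrite -/g; lia.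
  rewrite -(leq_exp2l _ _ (prime_gt1 pp)).
  rewrite [(p ^ (_ + E))%N]expnD [(p ^ (w + _))%N]expnD [(p ^ (_ + k./2))%N]expnD.
  have pS : (p ^ (2 * (logn p s * N)) <= s ^ (2 * N))%N.
    rewrite mulnCA expnM; case: (2 * N)%N => // e; rewrite leq_exp2r //.
    by apply: dvdn_leq => //; apply: pfactor_dvdnn.
  have BE : (B <= 2 * (u + u0 + v) * N.+1 * p ^ k./2)%N.
    have h1 : (k.+1 <= 2 * p ^ k./2)%N.
      apply: leq_trans (leq_double_exp_half k) _; rewrite leq_mul2l /=.
      by case: (k./2) => // k'; rewrite leq_exp2r // prime_gt1.
    have h2 : (B <= (u + u0 + v) * N.+1 * k.+1)%N.
      by rewrite /B ik -mulnA affine_leq_mul.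
    apply: leq_trans h2 _.
    have -> : (2 * (u + u0 + v) * N.+1 * p ^ k./2 = (u + u0 + v) * N.+1 * (2 * p ^ k./2))%N by ring.
    by rewrite leq_mul2l h1 orbT.
  apply: leq_trans (leq_mul (leq_mul (leqnn _) pS) (leq_trans pE BE)) _.
  rewrite mulnA leq_mul2r; apply/orP; right; apply: leq_trans hw; by rewrite -!mulnA.
apply: (@vge_cancel w (mval s r + E)); apply: (vgeW key).
set M := mbin _ r; set M' := mbin _ r.
have -> : (p ^ (mval s r + E))%:R * (M / M' * a%:~R ^+ i) =
  ((p ^ mval s r)%:R * M) * ((p ^ E)%:R / M') * a%:~R ^+ i by rewrite expnD natrM; ring.
apply: vge0M; last by apply: vgeX; apply: vge_intr.
(* Writing alpha_j over [s] instead of the common denominator [v] keeps the denominator of alpha_0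
   out of the loss that is linear in the degree. *)
apply: vge0M; first by rewrite /M ut; apply: vge_mbin.
apply: vge_mbin_inv => //; first by rewrite addn_gt0 ugt0.
move=> l lr; rewrite trunc_log_max ?prime_gt1 //.
have l0 : (0 < u + u0 + l * v)%N by rewrite -addnA addn_gt0 ugt0.
apply: leq_trans (dvdn_leq l0 (pfactor_dvdnn p _)) _.
by rewrite leq_add2l leq_mul2r (leq_trans (ltnW lr) ri) orbT.
Qed.
End Vge.

Definition K1 (m v A : nat) : nat := (256 ^ (A + A) * Kq m A)%N.
(** The factor v^6 256^v comes from [padeDelta], 2 [Cq] from the coefficients of Q phi_j, and the
    last 2 from the number of terms in the value at beta. *)
Definition C1 (m v A : nat) : nat := (v ^ 6 * 256 ^ v * (2 * Cq m v A) * 2)%N.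

Lemma expn_swap_le x b i M N : (b <= x)%N -> (i <= M <= N)%N ->
  (x ^ i * b ^ (N - i) <= x ^ M * b ^ (N - M))%N.
Proof.
move=> bx /andP[iM MN]; have -> : (N - i = (M - i) + (N - M))%N by lia.
have -> : (x ^ M = x ^ i * x ^ (M - i))%N by rewrite -expnD subnKC.
rewrite expnD !mulnA leq_mul2r; apply/orP; right.
by rewrite leq_mul2l (_ : b ^ (M - i) <= x ^ (M - i))%N ?orbT //; case: (M - i)%N => // e; rewrite leq_exp2r.
Qed.

(** * The nonzero integer Z and its two sizes *)

Section Core.
Variables (m v A s T : nat) (u t n : nat -> nat) (p b w : nat) (a : int) (l : nat -> int).
Hypothesis v0 : (0 < v)%N.
Hypothesis s0 : (0 < s)%N.
Hypothesis u0 : forall j, (j <= m)%N -> (0 < u j <= A)%N.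
Hypothesis al_int : forall i j, (1 <= i <= m)%N -> (1 <= j <= m)%N -> i != j ->
  alq v u i - alq v u j \isn't a Num.int.
Hypothesis a0 : a != 0.
Hypothesis b0 : (0 < b)%N.
Hypothesis n_gt0 : forall j, (j <= m)%N -> (0 < n j)%N.
Hypothesis n_lt : forall j, (0 < j <= m)%N -> (n j < n 0)%N.
Let N := (\sum_(j < m.+1) n j)%N.
Hypothesis NT : (N <= T)%N.
Hypothesis lnz : exists j, (j <= m)%N /\ l j != 0.
Let beta : rat := a%:~R / b%:R.
Definition linform : rat := \sum_(j < m.+1) (l j)%:~R * (padePhi (alq v u) T j).[beta].

(* Row k of the Pade matrix uses the indices n - e_k. *)
Definition shifted (k j : nat) : nat := (n j - (j == k))%N.

Lemma N_gt0 : (0 < N)%N.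
Proof. by rewrite /N big_ord_recl /= addn_gt0 n_gt0. Qed.

Lemma shiftedN (k : 'I_m.+1) : padeN m (shifted k) = N.-1.
Proof.
have -> : padeN m (shifted k) = (\sum_(j < m.+1) shifted k j)%N by rewrite big_ord_recl.
rewrite /N (bigD1 k) //= [in RHS](bigD1 k) //= /shifted eqxx.
have -> : (\sum_(j < m.+1 | j != k) (n j - (val j == k)) = \sum_(j < m.+1 | j != k) n j)%N.
  by apply: eq_bigr => j; rewrite -val_eqE /= => /negbTE ->; rewrite subn0.
have := n_gt0 (leq_ord k); rewrite /=; case: (n k) => // x _; by rewrite addSn subn1.
Qed.

(** Strictness of n_j < n_0 pays for row 0, where n_0 itself is lowered. *)
Lemma shifted_le k j : (j <= m)%N -> (shifted k j <= shifted k 0)%N.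
Proof.
rewrite /shifted; case: j => [//|j] jm; have := n_lt (j := j.+1) jm.
by case: (j.+1 == k); case: (0%N == k) => /=; lia.
Qed.

Let Qk (k : 'I_m.+1) : {poly rat} := padeQ m (alq v u) (shifted k).
Let Phij (j : 'I_m.+1) : {poly rat} := padePhi (alq v u) T j.
(** The numerators of row k, whose indices sum to N - 1. The coefficients of Q phi_j between this
    cut and degree N vanish, so the rest starts at z^N; degree N - n_j is possible only on the
    diagonal. *)
Let Mkj (k j : 'I_m.+1) : {poly rat} :=
  take_poly (N - n j + (k == j))%N (Qk k * Phij j).
Let Skj (k j : 'I_m.+1) : {poly rat} := drop_poly N (Qk k * Phij j).

Lemma n_leN (j : 'I_m.+1) : (n j <= N)%N.
Proof. by rewrite /N (bigD1 j) //= leq_addr. Qed.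

Lemma shifted_deg (k j : 'I_m.+1) : (N - n j + (k == j) = (N.-1 - shifted k j).+1)%N.
Proof.
have nN := n_leN j; have nj0 := n_gt0 (leq_ord j); have N0 := N_gt0.
have [->|kj] := eqVneq k j; first by rewrite /shifted eqxx /= subn1 addn1; lia.
have nN' : (n j + n k <= N)%N.
  by rewrite /N (bigD1 j) //= (bigD1 k) //= leq_add2l leq_addr.
have nk0 := n_gt0 (leq_ord k).
have -> : shifted k j = n j by rewrite /shifted eq_sym (negbTE kj : (val k == val j) = false) subn0.
rewrite addn0; lia.
Qed.

Lemma shiftedN_lt (k : 'I_m.+1) : (padeN m (shifted k) < T)%N.
Proof. by rewrite shiftedN; have := N_gt0; lia. Qed.

Let al_gt0 j := @alq_gt0 m v A u v0 u0 j.

Lemma Mkj_split k j : Mkj k j = Qk k * Phij j + (- Skj k j) * 'X^N.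
Proof.
apply/eqP; rewrite mulNr eq_sym subr_eq eq_sym; apply/eqP.
rewrite -[RHS](poly_take_drop N) /Skj; congr (_ + _).
apply/polyP => i; rewrite !coef_take_poly shifted_deg.
have := N_gt0 => N0.
case: (ltnP i N) => iN; case: ltnP => // i1; last first.
  by clear -N0 iN i1; lia.
symmetry; apply: (padeQPhi_vanish al_gt0 (@shifted_le k) (shiftedN_lt k) (leq_ord j)).
by rewrite shiftedN i1 /=; lia.
Qed.

Lemma Skj0 k : Skj k ord0 = 0.
Proof.
apply/polyP => i; rewrite coef_drop_poly coef0 /Phij mulr1 nth_default //.
apply: leq_trans (size_poly _ _) _; have := shiftedN k; have := N_gt0.
rewrite /padeN; lia.
Qed.

Lemma det_Mkj : \det (\matrix_(k, j) (Mkj k j).[beta]) != 0.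
Proof.
have -> : \matrix_(k, j) (Mkj k j).[beta] = \matrix_(k, j) ((\matrix_(k, j) Mkj k j) k j).[beta].
  by apply/matrixP => k j; rewrite !mxE.
apply: (@pade_det_horner m N (\matrix_(k, j) Mkj k j) (\matrix_(k, j) - Skj k j) Qk Phij
  (fun j : 'I_m.+1 => N - n j)%N beta) => //.
- by move=> k; rewrite !mxE Skj0 oppr0.
- by move=> k j; rewrite !mxE Mkj_split.
- by move=> k j; rewrite !mxE; apply: size_take_poly.
- move=> k; rewrite !mxE coef_take_poly eqxx addn1 ltnSn.
  have -> : (N - n k = N.-1 - shifted k k)%N by have := shifted_deg k k; rewrite eqxx; lia.
  rewrite -(shiftedN k).
  exact: (padeQPhi_lead al_gt0 (@shifted_le k) (shiftedN_lt k) al_int (leq_ord k)).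
- have : (\sum_(j < m.+1) (N - n j) + N = m.+1 * N)%N.
    rewrite {2}/N -big_split /=; under eq_bigr => j _ do rewrite subnK ?n_leN //.
    by rewrite sum_nat_const card_ord.
  by rewrite addnC mulSn => /addnI.
by rewrite mulf_neq0 ?invr_eq0 // ?intr_eq0 // pnatr_eq0 -lt0n.
Qed.

Lemma row_neq0 : exists k : 'I_m.+1, \sum_j (Mkj k j).[beta] * (l j)%:~R != 0.
Proof.
have [|k Hk] := @det_neq0_row _ _ (fun j : 'I_m.+1 => (l j)%:~R) det_Mkj.
  by case: lnz => j [jm lj]; exists (inord j); rewrite intr_eq0 inordK.
exists k; apply: contraNneq Hk => E; apply/eqP; rewrite -[RHS]E.
by apply: eq_bigr => j _; rewrite mxE.
Qed.

Let Dk (k : 'I_m.+1) : nat := padeDelta m v A (shifted k).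

Lemma betaM i M : (i <= M)%N -> b%:R ^+ M * beta ^+ i = a%:~R ^+ i * b%:R ^+ (M - i).
Proof.
move=> iM; have bn : b%:R != 0 :> rat by rewrite pnatr_eq0 -lt0n.
rewrite /beta expr_div_n -{1}(subnK iM) exprD; field.
by rewrite expf_neq0.
Qed.

Lemma Mkj_int k j : (Dk k)%:R * b%:R ^+ N * (Mkj k j).[beta] \is a Num.int.
Proof.
rewrite (horner_coef_wide _ (size_take_poly _ _)) mulr_sumr rpred_sum // => i _.
have iN : (i <= N.-1)%N.
  by have := ltn_ord i; rewrite [X in (_ < X)%N]shifted_deg ltnS => h; apply: leq_trans h (leq_subr _ _).
rewrite coef_take_poly ltn_ord mulrACA betaM; last by apply: leq_trans iN (leq_pred _).
rewrite rpredM //; last by rewrite rpredM // rpredX ?natr_int ?intr_int.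
by apply: (@padeDelta_QPhi_int m v A); rewrite ?leq_ord ?shiftedN //; apply: shifted_le.
Qed.

Hypothesis ba : (b <= absz a)%N.

Lemma Mkj_norm k j : `|(Dk k)%:R * b%:R ^+ N * (Mkj k j).[beta]| <=
  (K1 m v A * C1 m v A ^ N * (absz a ^ (N - n j) * b ^ n j))%:R.
Proof.
have Nn := n_leN j; have N0 := N_gt0.
rewrite (horner_coef_wide _ (size_take_poly _ _)) mulr_sumr.
apply: le_trans (ler_norm_sum _ _ _) _.
set X := (absz a ^ (N - n j) * b ^ n j)%N.
apply: (@le_trans _ _ (\sum_(i < (N - n j + (k == j))%N) (Dk k * (Kq m A * (2 * Cq m v A) ^ N.-1) * X)%:R)).
  apply: ler_sum => i _.
  have iN : (i <= N.-1)%N.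
    by have := ltn_ord i; rewrite [X in (_ < X)%N]shifted_deg ltnS => h; apply: leq_trans h (leq_subr _ _).
  rewrite coef_take_poly ltn_ord mulrACA betaM; last by apply: leq_trans iN (leq_pred _).
  rewrite natrM normrM; apply: ler_pM => //.
    rewrite natrM normrM; apply: ler_pM => //; first by rewrite ger0_norm ?ler0n.
    by rewrite -(shiftedN k); apply: padeQPhi_norm; rewrite ?leq_ord ?shiftedN //; apply: shifted_le.
  have an : `|a%:~R| = (absz a)%:R :> rat by rewrite -intr_norm -abszE -pmulrn.
  rewrite normrM !normrX an [`|b%:R|]ger0_norm ?ler0n // -!natrX -natrM ler_nat.
  have iM : (i <= N - n j <= N)%N.
    rewrite leq_subr andbT -ltnS; apply: leq_trans (ltn_ord i) _.
    by rewrite -[X in (_ <= X)%N]addn1 leq_add2l leq_b1.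
  by have := expn_swap_le ba iM; rewrite subKn.
rewrite sumr_const card_ord -[_ *+ _]mulr_natr -natrM ler_nat.
have cnt : (N - n j + (k == j) <= 2 ^ N)%N.
  apply: leq_trans (ltnW (ltn_expl N (ltnSn 1))).
  rewrite shifted_deg -{2}(prednK N0) ltnS leq_subr //.
have dk : (Dk k <= 256 ^ (A + A) * (v ^ 6 * 256 ^ v) ^ N.-1)%N.
  by rewrite -(shiftedN k); apply: padeDelta_le.
have le1 (x : nat) : (0 < x)%N -> (x ^ N.-1 <= x ^ N)%N.
  by move=> x0; rewrite leq_pexp2l // leq_pred.
have -> : (K1 m v A * C1 m v A ^ N * X = (256 ^ (A + A) * (v ^ 6 * 256 ^ v) ^ N) *
   (Kq m A * (2 * Cq m v A) ^ N) * X * 2 ^ N)%N.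
  by rewrite /K1 /C1 !(expnMn _ _ N); ring.
apply: leq_mul => //; apply: leq_mul => //; apply: leq_mul.
  apply: leq_trans dk _; rewrite leq_mul2l le1 ?orbT //.
  by rewrite muln_gt0 !expn_gt0 v0.
by rewrite leq_mul2l le1 ?orbT // !muln_gt0 expn_gt0.
Qed.

Hypothesis us : forall j, (0 < j <= m)%N -> (u j * s = t j * v)%N.
Hypothesis pp : prime p.
Hypothesis pb : ~~ (p %| b)%N.
Hypothesis conv : (logn p s < logn p (absz a))%N.
Hypothesis conv2 : p = 2%N -> (2 %| s)%N -> ((logn p s).+1 < logn p (absz a))%N.
Hypothesis pw : (p ^ w * (s ^ (2 * N) * (2 * (2 * A + v) * N.+1)) <= p ^ (logn p (absz a) * N))%N.
Hypothesis wl : vge p w linform.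

Lemma vge_beta i : vge p 0 (beta ^+ i).
Proof.
by rewrite -(mul0n i); apply: vgeX => //; apply: vge0M => //; [apply: vge0_int | apply: vge_inv].
Qed.

Lemma vge_DQ k i : vge p 0 ((Dk k)%:R * (Qk k)`_i).
Proof.
apply: vge0_int => //; apply: padeDelta_Q_int => //; exact: shifted_le.
Qed.

Lemma vge_Q k : vge p 0 ((Dk k)%:R * (Qk k).[beta]).
Proof.
rewrite horner_coef mulr_sumr; apply: vge_sum => // i _.
by rewrite mulrA; apply: vge0M => //; [apply: vge_DQ | apply: vge_beta].
Qed.

(** The index r and the power i differ because in Q phi_j a low coefficient of phi_j can meet a high
    power of beta. *)
Lemma vge_Phi_tail j r i : (N <= i)%N -> (r <= i)%N -> (0 < j <= m)%N ->
  vge p w ((padePhi (alq v u) T j)`_r * beta ^+ i).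
Proof.
move=> Ni ri jm; case: j jm => // j jm; rewrite coef_poly; case: ifP => _; last first.
  by rewrite mul0r; apply: vge_zero.
have [/andP[u00 u0A] /andP[uj0 ujA]] := (u0 (leq0n m), u0 (j := j.+1) jm).
rewrite /beta expr_div_n mulrA -[w]addn0; apply: vgeM => //; last first.
  by rewrite -natrX; apply: vge_inv; rewrite // Euclid_dvdX // negb_and pb.
have v_neq0 : v%:R != 0 :> rat by rewrite pnatr_eq0 -lt0n.
have s_neq0 : s%:R != 0 :> rat by rewrite pnatr_eq0 -lt0n.
apply: (vge_hcoef_tail pp (t := t j.+1) (s := s) (N := N)) => //.
  apply: (mulIf v_neq0); apply: (mulIf s_neq0).
  rewrite divfK // mulrAC divfK // -!natrM us // mulnC //.
apply: leq_trans pw; rewrite leq_mul2l; apply/orP; right.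
rewrite leq_mul2l; apply/orP; right; rewrite leq_mul2r; apply/orP; right.
rewrite leq_mul2l leq_add2r mul2n -addnn leq_add //.
Qed.

Lemma vge_S k j : vge p w ((Dk k)%:R * (Skj k j * 'X^N).[beta]).
Proof.
have [->|j0] := eqVneq j ord0; first by rewrite Skj0 mul0r horner0 mulr0; apply: vge_zero.
rewrite hornerM hornerXn horner_coef mulr_suml mulr_sumr; apply: vge_sum => // i _.
rewrite coef_drop_poly -mulrA -exprD coefM mulr_suml mulr_sumr; apply: vge_sum => // r _.
have assoc (x y z e : rat) : x * (y * z * e) = (x * y) * (z * e) by ring.
rewrite assoc; apply: vge0M => //; first exact: vge_DQ.
apply: vge_Phi_tail; rewrite ?leq_addl ?leq_subr //.
by rewrite leq_ord andbT lt0n.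
Qed.

(** In contrapositive form: the linear form is assumed divisible by p^w, and the conclusion limits
    w. *)
Theorem padic_linear_form_core :
  (p ^ w <= K1 m v A * C1 m v A ^ N *
    \sum_(j < m.+1) absz (l j) * (absz a ^ (N - n j) * b ^ n j))%N.
Proof.
have [k Hk] := row_neq0.
pose Z := (Dk k)%:R * b%:R ^+ N * \sum_(j < m.+1) (Mkj k j).[beta] * (l j)%:~R.
have b_neq0 : b%:R != 0 :> rat by rewrite pnatr_eq0 -lt0n.
have D0 : (Dk k)%:R != 0 :> rat.
  by rewrite pnatr_eq0 -lt0n muln_gt0 !expn_gt0 v0 lcmto_gt0.
have Z0 : Z != 0 by rewrite !mulf_neq0 // expf_neq0.
have ZE : Z = \sum_(j < m.+1) ((Dk k)%:R * b%:R ^+ N * (Mkj k j).[beta]) * (l j)%:~R.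
  by rewrite /Z mulr_sumr; apply: eq_bigr => j _; rewrite mulrA.
have Zint : Z \is a Num.int.
  by rewrite ZE rpred_sum // => j _; rewrite rpredM ?Mkj_int ?intr_int.
have Zvge : vge p w Z.
  have -> : Z = b%:R ^+ N * ((Dk k)%:R * (Qk k).[beta] * linform) -
     b%:R ^+ N * \sum_(j < m.+1) (l j)%:~R * ((Dk k)%:R * (Skj k j * 'X^N).[beta]).
    rewrite /Z /linform !mulr_sumr -sumrB; apply: eq_bigr => j _.
    rewrite Mkj_split mulNr hornerD hornerN [(Qk k * Phij j).[beta]]hornerM /Phij; ring.
  apply: vgeB => //; apply: vge0M => //; first by apply: vge0_int; rewrite // rpredX ?natr_int.
  - by apply: vge0M => //; apply: vge_Q.
  - by apply: vge0_int; rewrite // rpredX ?natr_int.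
  by apply: vge_sum => // j _; apply: vge0M => //; [apply: vge0_int | apply: vge_S].
case/intrP: Zint => z zE.
have z0 : z != 0 by rewrite -(intr_eq0 rat) -zE.
have := Zvge; rewrite zE => /(vge_intP pp) /(_ z0) H; apply: leq_trans H _.
rewrite -(ler_nat rat).
have -> : (absz z)%:R = `|Z| by rewrite zE -intr_norm -abszE -pmulrn.
rewrite ZE; apply: le_trans (ler_norm_sum _ _ _) _.
rewrite big_distrr natr_sum; apply: ler_sum => j _; rewrite normrM.
apply: le_trans (ler_pM _ _ (Mkj_norm k j) (lexx _)) _ => //.
rewrite -intr_norm -abszE -pmulrn -natrM ler_nat /= -mulnA leq_mul2l.
by rewrite [(absz (l j) * _)%N]mulnC leqnn orbT.
Qed.
End Core.

End PadeCore.

Require Import Defs.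
From Stdlib Require Import Reals ZArith QArith Qpower Qreals List Znumtheory.
From Stdlib Require Import Lra Lia.
Open Scope R_scope.

Module RatBridge.
Import all_boot all_order all_algebra zify ring ssrZ.
Import PadeCore.
Set Implicit Arguments. Unset Strict Implicit. Unset Printing Implicit Defensive.
Import Order.TTheory GRing.Theory Num.Theory.
Delimit Scope Z_scope with ZZ.
Local Open Scope ring_scope.

(** * Transfer to Q, Z and R *)

Definition Q2rat (x : Q) : rat := (int_of_Z (Qnum x))%:~R / (Pos.to_nat (Qden x))%:R.

Lemma Pos_neq0 d : (Pos.to_nat d)%:R != 0 :> rat.
Proof. by rewrite pnatr_eq0; apply/eqP; have := Pos2Nat.is_pos d; lia. Qed.

Lemma Q2rat_eq x y : Qeq x y -> Q2rat x = Q2rat y.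
Proof.
rewrite /Qeq /Q2rat => E; apply/eqP; rewrite eqr_div ?Pos_neq0 //; apply/eqP.
have : int_of_Z (Qnum x) * (Pos.to_nat (Qden y))%:Z = int_of_Z (Qnum y) * (Pos.to_nat (Qden x))%:Z by lia.
by move/(congr1 (fun z : int => z%:~R : rat)); rewrite !intrM -!pmulrn.
Qed.

Lemma Q2ratD x y : Q2rat (Qplus x y) = Q2rat x + Q2rat y.
Proof.
rewrite /Q2rat /Qplus /= Pos2Nat.inj_mul.
have -> : int_of_Z (Qnum x * Z.pos (Qden y) + Qnum y * Z.pos (Qden x))%Z =
  int_of_Z (Qnum x) * (Pos.to_nat (Qden y))%:Z + int_of_Z (Qnum y) * (Pos.to_nat (Qden x))%:Z by lia.
rewrite multE natrM intrD !intrM -!pmulrn; field; by rewrite !Pos_neq0.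
Qed.

Lemma Q2ratM x y : Q2rat (Qmult x y) = Q2rat x * Q2rat y.
Proof.
rewrite /Q2rat /Qmult /= Pos2Nat.inj_mul.
have -> : int_of_Z (Qnum x * Qnum y)%Z = int_of_Z (Qnum x) * int_of_Z (Qnum y) by lia.
by rewrite multE natrM intrM; field; rewrite !Pos_neq0.
Qed.

(** No condition on x, since both inverses send 0 to 0. *)
Lemma Q2ratV x : Q2rat (Qinv x) = (Q2rat x)^-1.
Proof.
case: x => [[|n|n] d]; rewrite /Q2rat /Qinv /=.
- by rewrite !mul0r invr0.
- by rewrite invf_div.
have E k : (Negz (Pos.to_nat k).-1)%:~R = - (Pos.to_nat k)%:R :> rat.
  by rewrite NegzE prednK ?intrN //; apply/ssrnat.ltP; exact: Pos2Nat.is_pos.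
by rewrite !E !mulNr invrN invf_div.
Qed.

Lemma Q2rat_div x y : Q2rat (Qdiv x y) = Q2rat x / Q2rat y.
Proof. by rewrite /Qdiv Q2ratM Q2ratV. Qed.

Lemma Q2rat_inject z : Q2rat (inject_Z z) = (int_of_Z z)%:~R.
Proof. by rewrite /Q2rat /= divr1. Qed.

Lemma Q2rat_nat n : Q2rat (inject_Z (Z.of_nat n)) = n%:R.
Proof. by rewrite Q2rat_inject (_ : int_of_Z (Z.of_nat n) = n%:Z) //; lia. Qed.

Lemma Q2rat_poch x n : Q2rat (poch x n) = rising (Q2rat x) n.
Proof.
elim: n => [|n IH]; first by rewrite rising0.
by rewrite [poch _ _]/= Q2ratM IH Q2ratD Q2rat_nat risingS.
Qed.

Lemma Q2rat_power x n : Q2rat (Qpower x (Z.of_nat n)) = Q2rat x ^+ n.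
Proof.
elim: n => [|n IH] //.
rewrite exprSr -IH -Q2ratM; apply: Q2rat_eq.
by case: n {IH} => [|n]; [rewrite /= Qmult_1_l; reflexivity|
  rewrite [X in Qpower x X](_ : _ = (Z.of_nat n.+1 + 1)%Z); [rewrite Qpower_plus'; [reflexivity|lia]|lia]].
Qed.

Lemma Q2rat_fold (I : Type) (f : I -> Q) (s : seq I) :
  Q2rat (List.fold_right Qplus (Qmake 0 1) (List.map f s)) = \sum_(i <- s) Q2rat (f i).
Proof.
elim: s => [|i s IH]; first by rewrite big_nil.
by rewrite big_cons [List.map _ _]/= [List.fold_right _ _ _]/= Q2ratD IH.
Qed.

Lemma List_seq_iota a n : List.seq a n = iota a n.
Proof. by elim: n a => //= n IH a; rewrite IH. Qed.

Lemma Q2rat_phi a0 aj z T : Q2rat (phi_partial a0 aj z T) =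
  (\poly_(r < T) hcoef (Q2rat a0) (Q2rat aj) r).[Q2rat z].
Proof.
rewrite /phi_partial Q2rat_fold List_seq_iota (horner_coef_wide _ (size_poly _ _)).
rewrite (_ : iota 0 T = index_iota 0 T) ?big_mkord; last by rewrite /index_iota subn0.
apply: eq_bigr => i _; rewrite coef_poly ltn_ord Q2ratM Q2rat_div !Q2rat_poch Q2ratD Q2rat_power.
by [].
Qed.

Lemma Q2rat_linform (alpha : nat -> Q) m l beta T (v : nat) (u : nat -> nat) :
  (forall j, (j <= m)%N -> Q2rat (alpha j) = alq v u j) ->
  Q2rat (linform_partial alpha m l beta T) =
  \sum_(j < m.+1) (int_of_Z (l j))%:~R * (padePhi (alq v u) T j).[Q2rat beta].
Proof.
move=> H; rewrite /linform_partial Q2ratD Q2rat_fold List_seq_iota Q2rat_inject.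
rewrite big_ord_recl /= hornerC mulr1; congr (_ + _).
rewrite (_ : iota 1 m = index_iota (0 + 1) m.+1); last by rewrite /index_iota subn1.
rewrite big_addn big_mkord subn1 /=.
apply: eq_bigr => j _; rewrite addn1 Q2ratM Q2rat_inject Q2rat_phi.
by rewrite !H.
Qed.

Lemma Zprime_prime p : Znumtheory.prime p -> prime.prime (Z.to_nat p).
Proof.
move=> pp; have p1 := prime_ge_2 _ pp; apply/primeP; split; first by lia.
move=> d /dvdnP[k E]; have /(prime_divisors _ pp) : (Z.of_nat d | p)%ZZ by exists (Z.of_nat k); lia.
by move=> H; apply/orP; rewrite -!(rwP eqP); lia.
Qed.

Lemma vpZ_logn p n : Znumtheory.prime p -> n <> 0%ZZ ->
  vpZ p n = logn (Z.to_nat p) (Z.abs_nat n).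
Proof.
move=> pp; rewrite /vpZ; have p1 := prime_ge_2 _ pp; have pp' := Zprime_prime pp.
(* The fuel is generalised to any f >= |n|; a quotient by p is strictly smaller, so one unit less is
   enough for it. *)
have : (Z.abs_nat n <= Z.to_nat (Z.abs n))%N by lia.
move: (Z.to_nat (Z.abs n)) => f; elim: f n => [|f IH] n nf n0; first by lia.
rewrite [vpZ_aux _ _ _]/=.
have -> : (n =? 0)%ZZ = false by apply/Z.eqb_neq.
case: Z.eqb_spec => H /=.
  have nE := Z_div_exact_full_2 n p ltac:(lia) H; set q := Z.div n p in nE *.
  have q0 : q <> 0%ZZ by lia.
  rewrite IH //; last by nia.
  have -> : Z.abs_nat n = (Z.to_nat p * Z.abs_nat q)%N by rewrite nE Zabs2Nat.inj_mul; lia.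
  have l1 : logn (Z.to_nat p) (Z.to_nat p) = 1%N by rewrite -{2}[Z.to_nat p]expn1 pfactorK.
  by rewrite lognM ?l1 //; lia.
apply/esym/eqP; rewrite eqn0Ngt logn_gt0 mem_primes pp' /=; apply/negP => /andP[_ /dvdnP[k E]].
apply: H; apply: Znumtheory.Zdivide_mod.
case: (Z.abs_eq_or_opp n) => nn; [exists (Z.of_nat k)|exists (- Z.of_nat k)%ZZ]; lia.
Qed.

Lemma absz_int_of_Z n : absz (int_of_Z n) = Z.abs_nat n.
Proof. lia. Qed.

Local Close Scope ring_scope.
Local Open Scope R_scope.

Lemma IZR_prime_gt1 p : Znumtheory.prime p -> 1 < IZR p.
Proof. by move=> pp; apply: IZR_lt; have := prime_ge_2 _ pp; lia. Qed.

Lemma padicQ_inject p z : Znumtheory.prime p -> z <> 0%ZZ ->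
  padicQ p (inject_Z z) = / (IZR p ^ logn (Z.to_nat p) (Z.abs_nat z)).
Proof.
move=> pp z0; rewrite /padicQ /=; have -> : (z =? 0)%ZZ = false by apply/Z.eqb_neq.
rewrite !vpZ_logn // (_ : Z.abs_nat 1 = 1%N) // logn1 /= pow_powerRZ -powerRZ_neg'.
by congr powerRZ; lia.
Qed.

Lemma powerRZ_le_exp_inv (p : R) (i : Z) (w : nat) : 1 < p ->
  powerRZ p i <= / p ^ w -> (i <= - Z.of_nat w)%ZZ.
Proof.
move=> p1 H; apply: Znot_gt_le => iw.
have : powerRZ p (- Z.of_nat w) < powerRZ p i.
  have -> : i = (- Z.of_nat w + Z.of_nat (Z.to_nat (i + Z.of_nat w)))%ZZ by lia.
  rewrite powerRZ_add; last by lra.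
  rewrite -[X in X < _]Rmult_1_r; apply: Rmult_lt_compat_l; first by apply: powerRZ_lt; lra.
  by rewrite -pow_powerRZ; apply: Rlt_pow_R1 => //; lia.
by rewrite powerRZ_neg' -pow_powerRZ; lra.
Qed.

(** The fraction need not be reduced: multiplying by the p-part of its denominator leaves a
    numerator of valuation at least w + e, and p^e is then cancelled. *)
Lemma padicQ_vge p x w : Znumtheory.prime p -> padicQ p x <= / IZR p ^ w ->
  vge (Z.to_nat p) w (Q2rat x).
Proof.
move=> pp; rewrite /padicQ; have pp' := Zprime_prime pp.
case: Z.eqb_spec => x0 H.
  by rewrite /Q2rat x0 mul0r; apply: vge_zero.
move/(powerRZ_le_exp_inv (IZR_prime_gt1 pp)): H; rewrite !vpZ_logn //.
rewrite (_ : Z.abs_nat (Z.pos (Qden x)) = Pos.to_nat (Qden x)) //.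
set P := Z.to_nat p; set d := Pos.to_nat _; set e := logn P d => H.
have d0 : (0 < d)%N by apply/ssrnat.ltP; exact: Pos2Nat.is_pos.
have n0 : int_of_Z (Qnum x) != 0%R by apply/eqP; lia.
have := vge_intr pp' n0; rewrite absz_int_of_Z => /(@vgeW P _ (w + e)) V.
apply: (@vge_cancel P pp' w e).
have -> : ((P ^ e)%:R * Q2rat x)%R = ((int_of_Z (Qnum x))%:~R * ((P ^ e)%:R / d%:R))%R.
  by rewrite /Q2rat -/d; ring.
rewrite -[(w + e)%N]addn0; apply: vgeM => //; first by apply: V; rewrite -/P; lia.
exact: vge_pexp_div.
Qed.

Lemma Q2rat_inj x y : Q2rat x = Q2rat y -> Qeq x y.
Proof.
rewrite /Q2rat /Qeq => /eqP; rewrite eqr_div ?Pos_neq0 // => /eqP.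
set d := Pos.to_nat (Qden x); set d' := Pos.to_nat (Qden y) => E.
have /intr_inj : ((int_of_Z (Qnum x) * d'%:Z)%:~R = (int_of_Z (Qnum y) * d%:Z)%:~R :> rat)%R.
  by rewrite !intrM -!pmulrn.
rewrite /d /d'; lia.
Qed.

Lemma Q2rat_pos_num x : Qlt (inject_Z 0) x ->
  Q2rat x = ((Z.to_nat (Qnum x))%:R / (Pos.to_nat (Qden x))%:R)%R /\ (0 < Z.to_nat (Qnum x))%N.
Proof.
rewrite /Qlt /= => x0; split; last by lia.
by rewrite /Q2rat; congr (_ / _)%R; rewrite (_ : int_of_Z (Qnum x) = (Z.to_nat (Qnum x))%:Z%R) //; lia.
Qed.

Lemma common_denominator (alpha : nat -> Q) m :
  (forall j, (j <= m)%N -> Qlt (inject_Z 0) (alpha j)) ->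
  exists v A : nat, exists u : nat -> nat, [/\ (0 < v)%N,
    forall j, (j <= m)%N -> (0 < u j <= A)%N &
    forall j, (j <= m)%N -> Q2rat (alpha j) = alq v u j].
Proof.
move=> pos; pose d j := Pos.to_nat (Qden (alpha j)).
have d0 j : (0 < d j)%N by apply/ssrnat.ltP; exact: Pos2Nat.is_pos.
pose v := (\prod_(j < m.+1) d j)%N.
pose u j := (Z.to_nat (Qnum (alpha j)) * (v %/ d j))%N.
have v0 : (0 < v)%N by apply: prodn_gt0.
have dv j : (j <= m)%N -> (d j %| v)%N.
  by move=> jm; rewrite /v (bigD1 (Ordinal (jm : j < m.+1)%N)) //= dvdn_mulr.
exists v, (\sum_(j < m.+1) u j)%N, u; split=> // j jm; have [E n0] := Q2rat_pos_num (pos j jm).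
  apply/andP; split.
    by rewrite muln_gt0 n0 divn_gt0 // dvdn_leq // dv.
  by rewrite (bigD1 (Ordinal (jm : j < m.+1)%N)) //= leq_addr.
rewrite E /alq /u -{2}(divnK (dv j jm)) !natrM -/(d j).
have dn : ((d j)%:R != 0 :> rat)%R by rewrite pnatr_eq0 -lt0n.
have qn : ((v %/ d j)%:R != 0 :> rat)%R by rewrite pnatr_eq0 -lt0n divn_gt0 // dvdn_leq // dv.
by field; rewrite qn dn.
Qed.

Lemma fold_lcm_pos s : (forall x, List.In x s -> (0 < x)%ZZ) -> (0 < List.fold_right Z.lcm 1 s)%ZZ.
Proof.
elim: s => [|x s IH] H //=.
have h1 := H x (or_introl (erefl _)); have h2 := IH (fun y hy => H y (or_intror hy)).
have := Z.lcm_nonneg x (List.fold_right Z.lcm 1%ZZ s).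
have : Z.lcm x (List.fold_right Z.lcm 1%ZZ s) <> 0%ZZ by move/Z.lcm_eq_0; lia.
lia.
Qed.

Lemma fold_lcm_dvd s x : List.In x s -> (x | List.fold_right Z.lcm 1 s)%ZZ.
Proof.
elim: s => [//|y s IH] /= [->|/IH H]; first exact: Z.divide_lcm_l.
by apply: Z.divide_trans H _; apply: Z.divide_lcm_r.
Qed.

Lemma s_lcm_pos alpha m : (0 < s_lcm alpha m)%ZZ.
Proof. by apply: fold_lcm_pos => x /List.in_map_iff[j [<- _]]. Qed.

Lemma s_lcm_numerator (alpha : nat -> Q) m j : (1 <= j <= m)%N -> Qlt (inject_Z 0) (alpha j) ->
  exists t : nat, Q2rat (alpha j) = (t%:R / (Z.to_nat (s_lcm alpha m))%:R)%R.
Proof.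
move=> /andP[j1 jm] pos; pose x := Qred (alpha j).
have E : Q2rat (alpha j) = Q2rat x by apply: Q2rat_eq; symmetry; apply: Qred_correct.
have xpos : Qlt (inject_Z 0) x.
  by apply: (Qlt_le_trans _ _ _ pos); rewrite /x Qred_correct; apply: Qle_refl.
have [xE n0] := Q2rat_pos_num xpos.
have [k kE] : (Z.pos (Qden x) | s_lcm alpha m)%ZZ.
  apply: fold_lcm_dvd; apply/List.in_map_iff; exists j; split=> //.
  by apply/List.in_seq; lia.
have sp := s_lcm_pos alpha m.
have k0 : (0 < k)%ZZ by nia.
exists (Z.to_nat (Qnum x) * Z.to_nat k)%N.
have -> : Z.to_nat (s_lcm alpha m) = (Z.to_nat k * Pos.to_nat (Qden x))%N.
  by rewrite kE Z2Nat.inj_mul //; lia.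
rewrite E xE !natrM.
have kn : ((Z.to_nat k)%:R != 0 :> rat)%R by rewrite pnatr_eq0 -lt0n; lia.
by field; rewrite kn Pos_neq0.
Qed.

End RatBridge.

(** * The estimate over Z and R with two constants K and C *)

Module LinearFormBound.
Import all_boot all_order all_algebra zify ssrZ.
Import PadeCore RatBridge.
Set Implicit Arguments. Unset Strict Implicit. Unset Printing Implicit Defensive.
Import Order.TTheory GRing.Theory Num.Theory.
Delimit Scope Z_scope with ZZ.
Local Open Scope R_scope.

Fixpoint nsum (n : nat -> nat) (m : nat) : nat :=
  if m is k.+1 then (nsum n k + n k.+1)%N else n 0%N.

Lemma nsumE n m : nsum n m = (\sum_(j < m.+1) n j)%N.
Proof. by elim: m => [|m IH]; [rewrite big_ord1 | rewrite big_ord_recr /= IH]. Qed.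

Lemma INR_expn x k : INR (x ^ k)%N = INR x ^ k.
Proof. by elim: k => [|k IH] //; rewrite expnS mult_INR IH. Qed.

Lemma INR_leq x y : (x <= y)%N <-> INR x <= INR y.
Proof.
split=> [/ssrnat.leP|] H; first exact: le_INR.
by apply/ssrnat.leP; apply: INR_le.
Qed.

Lemma INR_ge1 x : (0 < x)%N -> 1 <= INR x.
Proof. by move=> x0; rewrite -[1]/(INR 1); apply/INR_leq. Qed.

Lemma INR_sum_le (F : nat -> nat) (B : R) k : (forall j, (j < k)%N -> INR (F j) <= B) ->
  INR (\sum_(j < k) F j)%N <= INR k * B.
Proof.
elim: k => [|k IH] H; first by rewrite big_ord0 /=; lra.
rewrite big_ord_recr plus_INR S_INR Rmult_plus_distr_r Rmult_1_l.
apply: Rplus_le_compat; last by apply: H.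
by apply: IH => j jk; apply: H; apply: ltnW.
Qed.

Lemma IZR_to_nat z : (0 <= z)%ZZ -> IZR z = INR (Z.to_nat z).
Proof. by move=> z0; rewrite INR_IZR_INZ Z2Nat.id. Qed.

Lemma IZR_abs z : IZR (Z.abs z) = INR (Z.abs_nat z).
Proof. by rewrite INR_IZR_INZ Zabs2Nat.id_abs. Qed.

Lemma padic_convergence p a s : Znumtheory.prime p -> a <> 0%ZZ -> (0 < s)%ZZ ->
  padicQ p (inject_Z a) < powerRZ 2 (- delta2 p s) * padicQ p (inject_Z s) ->
  (logn (Z.to_nat p) (Z.to_nat s) < logn (Z.to_nat p) (Z.abs_nat a))%N /\
  (Z.to_nat p = 2 -> (2 %| Z.to_nat s)%N ->
     (logn (Z.to_nat p) (Z.to_nat s)).+1 < logn (Z.to_nat p) (Z.abs_nat a))%N.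
Proof.
move=> pp a0 s0; have p1 := IZR_prime_gt1 pp.
rewrite !padicQ_inject //; last by lia.
rewrite (_ : Z.abs_nat s = Z.to_nat s); last by lia.
set g := logn _ (Z.abs_nat a); set sg := logn _ _.
have lt_exp x y : / IZR p ^ x < / IZR p ^ y -> (y < x)%N.
  move=> H; rewrite ltnNge; apply/negP => /ssrnat.leP xy.
  have := Rle_pow (IZR p) x y ltac:(lra) xy.
  have : 0 < IZR p ^ x by apply: pow_lt; lra.
  by move=> h0 h1; have := Rinv_le_contravar _ _ h0 h1; lra.
rewrite /delta2; case: Z.eqb_spec => p2 /=; last first.
  by rewrite Rmult_1_l => /lt_exp H; split=> // pe; exfalso; have := prime_ge_2 _ pp; lia.
case ev: (Z.even s).
  rewrite /= Rmult_1_r -{1}p2 -Rinv_mult => H.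
  have H' : (sg.+1 < g)%N by apply: lt_exp.
  by split=> //; apply: ltnW.
rewrite Rmult_1_l => /lt_exp H; split=> // _ s2.
exfalso; case/dvdnP: s2 => k E; have : Z.even s = true.
  by apply/Z.even_spec; exists (Z.of_nat k); lia.
by rewrite ev.
Qed.

Lemma K1_gt0 m v A : (0 < K1 m v A)%N.
Proof. by rewrite !muln_gt0 !expn_gt0. Qed.

Lemma C1_gt0 m A v : (0 < v)%N -> (0 < C1 m v A)%N.
Proof. by move=> v0; rewrite /C1 /Cq !muln_gt0 !expn_gt0 v0. Qed.

Local Opaque K1 C1.

Lemma muln_regroup x y z e f g :
  (x * y * z * (e * (f * g)) = x * z * e * (g * (y * f)))%N.
Proof. lia. Qed.

Lemma padic_linear_form_bound (m : nat) (alpha : nat -> Q) :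
  (forall j, (j <= m)%coq_nat -> Qlt (inject_Z 0) (alpha j)) ->
  (forall i j, (1 <= i)%coq_nat -> (i < j)%coq_nat -> (j <= m)%coq_nat ->
     ~ (exists k : Z, Qeq (Qminus (alpha i) (alpha j)) (inject_Z k))) ->
  exists K C : R, 1 <= K /\ 1 <= C /\
  forall p a b : Z, Znumtheory.prime p -> (1 <= b)%ZZ -> a <> 0%ZZ -> Z.gcd a b = 1%ZZ ->
    (b <= Z.abs a)%ZZ ->
    padicQ p (inject_Z a) <
      powerRZ 2 (- delta2 p (s_lcm alpha m)) * padicQ p (inject_Z (s_lcm alpha m)) ->
  forall (n : nat -> nat) (l : nat -> Z) (w T : nat) (B : R),
    (forall j, (j <= m)%coq_nat -> (1 <= n j)%coq_nat) ->
    (forall j, (1 <= j)%coq_nat -> (j <= m)%coq_nat -> (n j < n 0%nat)%coq_nat) ->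
    (exists j, (j <= m)%coq_nat /\ l j <> 0%ZZ) ->
    (nsum n m <= T)%coq_nat ->
    IZR p ^ w * (K * C ^ nsum n m) <= (/ padicQ p (inject_Z a)) ^ nsum n m ->
    padicQ p (linform_partial alpha m l (Qdiv (inject_Z a) (inject_Z b)) T) <= / IZR p ^ w ->
    (forall j, (j <= m)%coq_nat ->
       IZR (Z.abs (l j)) * (IZR (Z.abs a) ^ (nsum n m - n j) * IZR b ^ n j) <= B) ->
    IZR p ^ w <= K * C ^ nsum n m * B.
Proof.
move=> pos nonint.
have pos' j : (j <= m)%N -> Qlt (inject_Z 0) (alpha j) by move=> jm; apply: pos; apply/ssrnat.leP.
have [v [A [u [v0 uA alE]]]] := common_denominator pos'.
pose s := Z.to_nat (s_lcm alpha m); have sp := s_lcm_pos alpha m.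
have s0 : (0 < s)%N by rewrite /s; lia.
(* Both constants serve twice: in the smallness condition, where s^(2N) and N+1 <= 2^N go into (2
   s^2)^N, and in the size of Z, where m+1 counts the terms bounded by [B]. *)
pose Kn := (K1 m v A * (2 * (2 * A + v)) * m.+1)%N.
pose Cn := (C1 m v A * (2 * s ^ 2))%N.
have K1p := K1_gt0 m v A; have C1p := C1_gt0 m A v0.
have Kp : (0 < Kn)%N by rewrite /Kn 2!muln_gt0 K1p muln_gt0 addn_gt0 v0 orbT.
have Cp : (0 < Cn)%N by rewrite /Cn muln_gt0 C1p muln_gt0 expn_gt0 s0.
exists (INR Kn), (INR Cn); split; first exact: INR_ge1.
split; first exact: INR_ge1.
move=> p a b pp b1 a0 gab ba conv n l w T B n1 n0 lnz NT pw wl lB.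
set N := nsum n m in NT pw lB *.
have [cv1 cv2] := padic_convergence pp a0 sp conv.
have p2 := prime_ge_2 _ pp.
have pp' := Zprime_prime pp.
have us j : (0 < j <= m)%N -> (u j * s = (u j * s %/ v) * v)%N.
  move=> /andP[j1 jm]; have [t tE] := s_lcm_numerator (m := m) (j := j) ltac:(by rewrite j1) (pos' j jm).
  suff -> : (u j * s = t * v)%N by rewrite mulnK.
  move: tE; rewrite (alE j jm) /alq => /eqP; rewrite eqr_div ?pnatr_eq0 -?lt0n //.
  by rewrite -!natrM eqr_nat => /eqP.
have alint i j : (1 <= i <= m)%N -> (1 <= j <= m)%N -> i != j ->
    (alq v u i - alq v u j)%R \isn't a Num.int.
  wlog ij : i j / (i < j)%N => [W|] iP jP nij.
    case: (ltngtP i j) => h; [exact: W| |by rewrite h eqxx in nij].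
    by rewrite -rpredN opprB; apply: W; rewrite // eq_sym.
  apply/negP => /intrP[z zE]; apply: (nonint i j); try (apply/ssrnat.leP; lia).
  exists (Z_of_int z); apply: Q2rat_inj.
  have jm : (j <= m)%N by lia.
  have im : (i <= m)%N by lia.
  rewrite /Qminus Q2ratD Q2rat_inject (_ : Q2rat (Qopp (alpha j)) = - Q2rat (alpha j))%R.
    by rewrite !alE // zE; congr (_%:~R)%R; lia.
  rewrite /Q2rat /= (_ : int_of_Z (- Qnum (alpha j)) = - int_of_Z (Qnum (alpha j)))%R;
    by rewrite ?intrN ?mulNr //; lia.
have NE : N = (\sum_(j < m.+1) n j)%N by rewrite /N nsumE.
have pR : IZR p = INR (Z.to_nat p) by apply: IZR_to_nat; lia.
(* p divides a because v_p(a) > v_p(s) >= 0, and a and b are coprime. *)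
have pb : ~~ (Z.to_nat p %| Z.to_nat b)%N.
  apply/negP => /dvdnP[k kE].
  have /dvdnP[k' k'E] : (Z.to_nat p %| Z.abs_nat a)%N.
    have : (0 < logn (Z.to_nat p) (Z.abs_nat a))%N by apply: leq_ltn_trans cv1.
    by rewrite logn_gt0 mem_primes => /and3P[].
  have : (p | 1)%ZZ.
    rewrite -gab; apply: Z.gcd_greatest; last by exists (Z.of_nat k); lia.
    by apply/Z.divide_abs_r; exists (Z.of_nat k'); lia.
  by move/Z.divide_1_r_nonneg; lia.
have pw' : (Z.to_nat p ^ w * (s ^ (2 * N) * (2 * (2 * A + v) * N.+1)) <=
   Z.to_nat p ^ (logn (Z.to_nat p) (absz (int_of_Z a)) * N))%N.
  apply: (@leq_trans (Z.to_nat p ^ w * (Kn * Cn ^ N))%N).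
    rewrite leq_mul2l; apply/orP; right.
    have -> : (Kn * Cn ^ N = (K1 m v A * m.+1 * C1 m v A ^ N) *
        (s ^ (2 * N) * (2 * (2 * A + v) * 2 ^ N)))%N.
      by rewrite /Kn /Cn 2!expnMn -expnM muln_regroup.
    apply: leq_trans (leq_pmull _ _); last by rewrite 2!muln_gt0 K1p expn_gt0 C1p.
    rewrite leq_mul2l; apply/orP; right; rewrite leq_mul2l; apply/orP; right.
    exact: ltn_expl.
  apply/INR_leq; rewrite 2!mult_INR 3!INR_expn -pR absz_int_of_Z -multE pow_mult.
  apply: Rle_trans pw _; by rewrite padicQ_inject // Rinv_inv; apply: Rle_refl.
have beta_E : Q2rat (Qdiv (inject_Z a) (inject_Z b)) = ((int_of_Z a)%:~R / (Z.to_nat b)%:R)%R.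
  by rewrite Q2rat_div !Q2rat_inject (_ : int_of_Z b = (Z.to_nat b)%:Z%R) //; clear -b1; lia.
have key := @padic_linear_form_core m v A s T u (fun j => u j * s %/ v)%N n (Z.to_nat p)
  (Z.to_nat b) w (int_of_Z a) (fun j => int_of_Z (l j)) v0 s0 uA alint.
have {key} key : (Z.to_nat p ^ w <= K1 m v A * C1 m v A ^ N *
    \sum_(j < m.+1) Z.abs_nat (l j) * (Z.abs_nat a ^ (N - n j) * Z.to_nat b ^ n j))%N.
  have := key; rewrite -NE; under eq_bigr => j _ do rewrite absz_int_of_Z.
  rewrite absz_int_of_Z; apply=> //.
  - by apply/eqP; clear -a0; lia.
  - by clear -b1; lia.
  - by move=> j /ssrnat.leP jm; apply/ssrnat.leP; apply: n1.
  - by move=> j /andP[/ssrnat.leP j1 /ssrnat.leP jm]; apply/ssrnat.leP; apply: n0.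
  - exact/ssrnat.leP.
  - case: lnz => j [/ssrnat.leP jm lj]; exists j; split=> //; apply/eqP; clear -lj; lia.
  - by clear -b1 ba; lia.
  - by rewrite -absz_int_of_Z.
  - rewrite /linform -beta_E -(Q2rat_linform _ _ _ alE); exact: padicQ_vge.
move/INR_leq: key; rewrite INR_expn -pR => key; apply: Rle_trans key _.
rewrite mult_INR mult_INR INR_expn.
have B0 : 0 <= B.
  apply: Rle_trans (lB 0%N (Nat.le_0_l m)); apply: Rmult_le_pos; first by apply: IZR_le; exact: Z.abs_nonneg.
  by apply: Rmult_le_pos; apply: pow_le; apply: IZR_le; [exact: Z.abs_nonneg | clear -b1; lia].
have S := @INR_sum_le (fun j => Z.abs_nat (l j) * (Z.abs_nat a ^ (N - n j) * Z.to_nat b ^ n j))%N B m.+1.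
have {S} S : INR (\sum_(j < m.+1) Z.abs_nat (l j) * (Z.abs_nat a ^ (N - n j) * Z.to_nat b ^ n j))%N
    <= INR m.+1 * B.
  apply: S => j jm; rewrite !mult_INR !INR_expn -!IZR_abs -IZR_to_nat; last by clear -b1; lia.
  by apply: lB; apply/ssrnat.leP.
have k1 := INR_ge1 K1p; have c1 := INR_ge1 C1p.
apply: Rle_trans (Rmult_le_compat_l _ _ _ _ S) _.
  by apply: Rmult_le_pos; [lra | apply: pow_le; lra].
rewrite -Rmult_assoc; apply: Rmult_le_compat_r => //.
have -> : INR (K1 m v A) * INR (C1 m v A) ^ N * INR m.+1 =
   INR (K1 m v A * m.+1)%N * INR (C1 m v A) ^ N.
  by rewrite (mult_INR (K1 m v A) m.+1) Rmult_assoc [_ ^ N * _]Rmult_comm -Rmult_assoc.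
apply: Rmult_le_compat; [exact: pos_INR|by apply: pow_le; lra| |].
  apply/INR_leq; rewrite /Kn mulnAC; apply: leq_pmulr.
  by rewrite muln_gt0 addn_gt0 v0 orbT.
apply: pow_incr; split; first by lra.
apply/INR_leq; apply: leq_pmulr; by rewrite muln_gt0 expn_gt0 s0.
Qed.

End LinearFormBound.

(** * Choice of the indices *)

Lemma exp_INR_ln (x : R) (k : nat) : 0 < x -> x ^ k = exp (INR k * ln x).
Proof. intros Hx. rewrite <- Rpower_pow by assumption. reflexivity. Qed.

Lemma exp_le (x y : R) : x <= y -> exp x <= exp y.
Proof. intros [H | ->]; [left; now apply exp_increasing | right; reflexivity]. Qed.

Lemma ln_mono (x y : R) : 0 < x -> x <= y -> ln x <= ln y.
Proof.
  intros Hx [H | ->]; [left; now apply ln_increasing | right; reflexivity].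
Qed.

Lemma nat_ceil (x : R) : 0 <= x -> exists k : nat, (1 <= k)%nat /\ x < INR k <= x + 1.
Proof.
  intros Hx. destruct (archimed x) as [H1 H2].
  assert (Hu : (0 < up x)%Z) by (apply lt_IZR; lra).
  exists (Z.to_nat (up x)). rewrite INR_IZR_INZ, Z2Nat.id by lia.
  split; [lia | lra].
Qed.

Lemma fold_mul_seq_S (g : nat -> Z) (k : nat) :
  fold_right Z.mul 1%Z (map g (seq 1 (S k))) =
  (fold_right Z.mul 1 (map g (seq 1 k)) * g (S k))%Z.
Proof.
  assert (Happ : forall s z, fold_right Z.mul z s = (fold_right Z.mul 1 s * z)%Z).
  { induction s as [| x s IH]; intros z; cbn [fold_right].
    - lia.
    - rewrite IH. ring. }
  rewrite seq_S, map_app, fold_right_app, Happ. cbn. ring.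
Qed.

Lemma fold_mul_pos (g : nat -> Z) (k : nat) : (forall j, (1 <= g j)%Z) ->
  (1 <= fold_right Z.mul 1 (map g (seq 1 k)))%Z.
Proof.
  intros Hg. induction k as [| k IH]; [cbn; lia |].
  rewrite fold_mul_seq_S. specialize (Hg (S k)). nia.
Qed.

Lemma h0_ge (l : nat -> Z) (m j : nat) : (j <= m)%nat -> (Z.abs (l j) <= h0 l m)%Z.
Proof.
  intros Hj. unfold h0.
  assert (Hin : In j (seq 0 (S m))) by (apply in_seq; lia).
  revert Hin. generalize (seq 0 (S m)) as s. induction s as [| i s IH]; [easy |].
  cbn [map fold_right]. intros [-> | Hin]; [lia | specialize (IH Hin); lia].
Qed.

Lemma nsum_ge (n : nat -> nat) (m j : nat) : (j <= m)%nat -> (n j <= LinearFormBound.nsum n m)%nat.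
Proof.
  intros Hj. induction m as [| m IH].
  - replace j with 0%nat by lia. apply le_n.
  - change (LinearFormBound.nsum n (S m)) with (LinearFormBound.nsum n m + n (S m))%nat.
    destruct (Nat.eq_dec j (S m)) as [-> | Hne]; [lia | specialize (IH ltac:(lia)); lia].
Qed.

(* The indices balance the m + 1 terms of the linear form: (|a|/b)^(n_j) >= h_j H^delta. *)
Lemma balanced_indices (m : nat) (l : nat -> Z) (lA delta : R) :
  0 < lA -> 0 <= delta -> (1 <= h0 l m)%Z ->
  exists n : nat -> nat,
    (forall j, (j <= m)%nat -> (1 <= n j)%nat) /\
    (forall j, (1 <= j)%nat -> (j <= m)%nat -> (n j < n 0%nat)%nat) /\
    (forall j, (j <= m)%nat -> l j <> 0%Z ->
       ln (IZR (Z.abs (l j))) + delta * ln (IZR (Htilde l m)) <= INR (n j) * lA) /\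
    (1 + (INR m + 1) * delta) * ln (IZR (Htilde l m)) <= INR (LinearFormBound.nsum n m) * lA <=
      (1 + (INR m + 1) * delta) * ln (IZR (Htilde l m)) + (INR m + 2) * lA.
Proof.
  intros HlA Hdelta Hh0. set (h := ln (IZR (Htilde l m))).
  set (g := fun j => Z.max 1 (Z.abs (l j))).
  set (F := fun k => fold_right Z.mul 1%Z (map g (seq 1 k))).
  assert (HF : forall k, (1 <= F k)%Z) by (intros k; apply fold_mul_pos; intros j; unfold g; lia).
  assert (Hln : forall z, (1 <= z)%Z -> 0 <= ln (IZR z)).
  { intros z Hz. rewrite <- ln_1. apply IZR_le in Hz. apply ln_mono; lra. }
  assert (Hh : 0 <= h).
  { apply Hln. unfold Htilde. fold g. change (1 <= h0 l m * F m)%Z. specialize (HF m). nia. }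
  set (hh := fun j => match j with O => h0 l m | S _ => g j end).
  assert (Hhh1 : forall j, (1 <= hh j)%Z) by (intros [| j]; [exact Hh0 | unfold hh, g; lia]).
  assert (Hhh0 : forall j, (j <= m)%nat -> (hh j <= h0 l m)%Z).
  { intros [| j] Hj; [apply Z.le_refl |]. unfold hh, g. pose proof (h0_ge l m (S j) Hj). lia. }
  assert (Hlh : forall j, (j <= m)%nat -> (Z.abs (l j) <= hh j)%Z).
  { intros [| j] Hj; [now apply h0_ge | unfold hh, g; lia]. }
  set (r := fun j => (ln (IZR (hh j)) + delta * h) / lA).
  assert (Hr0 : forall j, 0 <= r j).
  { intros j. unfold r. apply Rmult_le_pos; [| left; now apply Rinv_0_lt_compat].
    specialize (Hln _ (Hhh1 j)). nra. }
  set (c := fun j => Z.to_nat (up (r j))).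
  assert (Hc : forall j, (1 <= c j)%nat /\ r j < INR (c j) <= r j + 1).
  { intros j. destruct (archimed (r j)) as [H1 H2]. specialize (Hr0 j).
    assert (Hu : (0 < up (r j))%Z) by (apply lt_IZR; lra).
    unfold c. rewrite INR_IZR_INZ, Z2Nat.id by lia. split; [lia | lra]. }
  (* The extra 1 in n_0 gives n_j < n_0 from c_j <= r_j + 1 <= r_0 + 1 < c_0 + 1; with the m+1
     roundings it accounts for the error (m+2) [lA]. *)
  set (n := fun j => match j with O => S (c O) | S _ => c j end).
  assert (HrlA : forall j, r j * lA = ln (IZR (hh j)) + delta * h).
  { intros j. unfold r. field. lra. }
  assert (Hcl : forall j, ln (IZR (hh j)) + delta * h <= INR (c j) * lA <=
      ln (IZR (hh j)) + delta * h + lA).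
  { intros j. destruct (Hc j) as [_ [H1 H2]]. rewrite <- (HrlA j). nra. }
  assert (Hnc : forall j, (c j <= n j)%nat) by (intros [| j]; unfold n; lia).
  exists n. split; [| split; [| split]].
  - intros j _. specialize (Hnc j). destruct (Hc j). lia.
  - intros [| j] Hj1 Hj; [lia |]. unfold n.
    assert (Hrr : r (S j) <= r 0%nat).
    { unfold r. apply Rmult_le_compat_r; [left; now apply Rinv_0_lt_compat |].
      apply Rplus_le_compat_r. apply ln_mono.
      - apply IZR_lt. specialize (Hhh1 (S j)). lia.
      - apply IZR_le. now apply Hhh0. }
    destruct (Hc (S j)) as [_ [_ H1]], (Hc 0%nat) as [_ [H2 _]].
    assert (H3 : INR (c (S j)) < INR (S (c 0%nat))) by (rewrite S_INR; lra).
    now apply INR_lt.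
  - intros j Hj Hlj. destruct (Hcl j) as [H1 _].
    assert (H2 : ln (IZR (Z.abs (l j))) <= ln (IZR (hh j))).
    { apply ln_mono; [apply IZR_lt; lia | apply IZR_le; now apply Hlh]. }
    pose proof (le_INR _ _ (Hnc j)) as H3. fold h. nra.
  - assert (Hsum : forall k,
      ln (IZR (h0 l m)) + ln (IZR (F k)) + (INR k + 1) * (delta * h) <= INR (LinearFormBound.nsum n k) * lA <=
      ln (IZR (h0 l m)) + ln (IZR (F k)) + (INR k + 1) * (delta * h) + (INR k + 2) * lA).
    { induction k as [| k IH].
      - change (F 0%nat) with 1%Z. rewrite ln_1.
        change (LinearFormBound.nsum n 0) with (S (c 0%nat)). rewrite S_INR. cbn [INR].
        specialize (Hcl 0%nat). change (hh 0%nat) with (h0 l m) in Hcl. lra.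
      - change (LinearFormBound.nsum n (S k)) with (LinearFormBound.nsum n k + c (S k))%nat.
        unfold F. rewrite fold_mul_seq_S. fold (F k). rewrite mult_IZR, ln_mult, plus_INR, S_INR.
        + specialize (Hcl (S k)). change (hh (S k)) with (g (S k)) in Hcl. lra.
        + apply IZR_lt. specialize (HF k). lia.
        + apply IZR_lt. unfold g. lia. }
    specialize (Hsum m).
    assert (Hhsplit : h = ln (IZR (h0 l m)) + ln (IZR (F m))).
    { unfold h, Htilde. rewrite mult_IZR, ln_mult; [reflexivity | apply IZR_lt; lia |].
      apply IZR_lt. change (0 < F m)%Z. specialize (HF m). lia. }
    fold h. rewrite <- Hhsplit in Hsum. lra.
Qed.

(* la, lb, lG, lp, lK, lC, h are the logarithms of |a|, b, 1/|a|_p, p, K, C and H, NN is the sum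
   of the indices and eps / (4 M) is delta. *)
Lemma exponent_budget (M eps h la lb lG lp lK lC NN : R) :
  2 <= M -> 0 < eps < 1 -> 0 <= lb -> 0 < la -> 2 * (M + eps) * lb <= eps * la ->
  0 <= lC <= eps / (100 * M) * la -> 0 <= lK -> 0 < lp ->
  (1 - eps / (8 * M)) * la <= lG -> 0 <= NN ->
  (1 + M * (eps / (4 * M))) * h <= NN * (la - lb) <=
    (1 + M * (eps / (4 * M))) * h + (M + 1) * (la - lb) ->
  100 * M / eps * (2 * lK + lp + 3 * (M + 1) * la) <= h ->
  let X := lK + NN * lC + NN * la - eps / (4 * M) * h in
  0 <= X /\ X + lp + lK + NN * lC <= NN * lG /\ X + lp <= (1 + eps) * h.
Proof.
  intros HM He Hlb Hla Hlbla HlC HlK Hlp HlG HNN HP Hh X.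
  set (q := eps / M).
  assert (HqM : q * M = eps) by (unfold q; field; lra).
  assert (Hq : 0 < q) by (unfold q; apply Rdiv_lt_0_compat; lra).
  assert (Hq1 : q <= 1 / 2) by nra.
  replace (eps / (4 * M)) with (q / 4) in * by (unfold q; field; lra).
  replace (eps / (100 * M)) with (q / 100) in * by (unfold q; field; lra).
  replace (eps / (8 * M)) with (q / 8) in * by (unfold q; field; lra).
  set (E := 2 * lK + lp + 3 * (M + 1) * la) in *.
  assert (HE : 0 < E) by (unfold E; nra).
  (* The threshold on h makes all terms that do not grow with h at most one hundredth of q h. *)
  assert (Hqh : 100 * E <= q * h).
  { apply Rmult_le_compat_l with (r := q) in Hh; [| lra].
    replace (q * (100 * M / eps * E)) with (100 * E) in Hh; [exact Hh |].
    unfold q. field. lra. }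
  assert (Hh0 : 0 < h) by nra.
  replace (1 + M * (q / 4)) with (1 + eps / 4) in HP by lra.
  set (R0 := NN * la) in *. set (B := NN * lb).
  replace (NN * (la - lb)) with (R0 - B) in HP by (unfold R0, B; ring).
  assert (HB0 : 0 <= B) by (unfold B; nra).
  assert (HR0 : 0 <= R0) by (unfold R0; nra).
  assert (HB : 2 * (2 + eps) * B <= eps * R0).
  { assert (H1 : NN * (2 * (M + eps) * lb) <= NN * (eps * la)) by (apply Rmult_le_compat_l; lra).
    assert (H2 : 2 * (M + eps) * B <= eps * R0) by (unfold B, R0; lra).
    nra. }
  (* The bound on B multiplies R0 - B by at most (4+2 eps)/(4+eps), which turns 1 + eps/4 into
     exactly 1 + eps/2. *)
  assert (HR : R0 <= (1 + eps / 2) * h + 6 / 5 * ((M + 1) * la)).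
  { assert (H1 : (4 + eps) * R0 <= (4 + 2 * eps) * (R0 - B)) by lra.
    assert (H2 : (4 + 2 * eps) * (R0 - B) <= (4 + 2 * eps) * ((1 + eps / 4) * h + (M + 1) * la)).
    { apply Rmult_le_compat_l; [lra |]. nra. }
    assert (H3 : (4 + eps) * R0 <= (4 + eps) * ((1 + eps / 2) * h + 6 / 5 * ((M + 1) * la))).
    { assert (0 <= (M + 1) * la) by nra. nra. }
    apply Rmult_le_reg_l in H3; lra. }
  assert (HC : NN * lC <= q / 100 * R0).
  { unfold R0. destruct HlC as [_ HlC]. apply Rmult_le_compat_l with (r := NN) in HlC; lra. }
  assert (HC0 : 0 <= NN * lC) by nra.
  assert (HG : (1 - q / 8) * R0 <= NN * lG).
  { unfold R0. apply Rmult_le_compat_l with (r := NN) in HlG; lra. }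
  assert (HML : 0 < (M + 1) * la) by nra.
  assert (HqML : q * ((M + 1) * la) <= 1 / 2 * ((M + 1) * la)) by (apply Rmult_le_compat_r; lra).
  assert (HR32 : R0 <= 3 / 2 * h + 6 / 5 * ((M + 1) * la)) by nra.
  assert (HqR : q * R0 <= 3 / 2 * (q * h) + 3 / 5 * ((M + 1) * la)).
  { apply Rmult_le_compat_l with (r := q) in HR32; lra. }
  assert (Heh : 2 * (q * h) <= eps * h).
  { rewrite <- HqM. assert (0 < q * h) by nra. nra. }
  assert (HRh : h <= R0) by nra.
  assert (HqhR : q * h <= 1 / 2 * h) by (apply Rmult_le_compat_r; lra).
  unfold X, E in *. replace (eps / (4 * M)) with (q / 4) by (unfold q; field; lra).
  (* Second claim: q h/4 against q R0/8 + 2 q R0/100, where q R0 is about 3 q h/2 at most. Third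
     claim: R0 uses up only eps h/2 of the available eps h. *)
  repeat split; lra.
Qed.

Theorem theorem2 (m : nat) (alpha : nat -> Q) (eps : R) :
  (1 <= m)%nat ->
  (forall j, (j <= m)%nat -> (0 < alpha j)%Q) ->
  (forall i j, (1 <= i)%nat -> (i < j)%nat -> (j <= m)%nat ->
     ~ (exists k : Z, (alpha i - alpha j == inject_Z k)%Q)) ->
  0 < eps < 1 ->
  exists c : R, 0 < c /\
  forall (p a b : Z),
    prime p ->
    (1 <= b)%Z -> a <> 0%Z -> Z.gcd a b = 1%Z ->
    Rpower (IZR (Z.abs a)) eps > c * Rpower (IZR b) (2 * (INR m + 1 + eps)) ->
    padicQ p (inject_Z a) <
      Rmin (powerRZ 2 (- delta2 p (s_lcm alpha m)) * padicQ p (inject_Z (s_lcm alpha m)))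
           (Rpower (IZR (Z.abs a)) (-1 + eps / (8 * (INR m + 1)))) ->
    exists H0 : R, 0 < H0 /\
    forall l : nat -> Z,
      (exists j, (j <= m)%nat /\ l j <> 0%Z) ->
      IZR (Htilde l m) >= H0 ->
      exists N0 : nat, forall N : nat, (N0 <= N)%nat ->
        padicQ p (linform_partial alpha m l (inject_Z a / inject_Z b)%Q N)
          > Rpower (IZR (Htilde l m)) (-1 - eps).
Proof.
  intros Hm Hpos Hnonint Heps.
  destruct (@LinearFormBound.padic_linear_form_bound m alpha Hpos Hnonint) as (K & C & HK & HC & Hcore).
  set (M := INR m + 1) in *.
  assert (HM : 2 <= M) by (unfold M; apply le_INR in Hm; cbn [INR] in Hm; lra).
  assert (HlK : 0 <= ln K) by (rewrite <- ln_1; apply ln_mono; lra).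
  assert (HlC : 0 <= ln C) by (rewrite <- ln_1; apply ln_mono; lra).
  (* Chosen so that ln C < eps/(100 M) ln |a|, which makes C^N negligible against |a|^N. *)
  exists (exp (100 * M * ln C)). split; [apply exp_pos |].
  intros p a b Hp Hb Ha Hgcd Habig Hpadic.
  apply Rmin_Rgt in Hpadic as [Hconv Hsmall].
  assert (Hp1 : 1 < IZR p) by (apply IZR_lt; pose proof (prime_ge_2 _ Hp); lia).
  assert (HaR : 0 < IZR (Z.abs a)) by (apply IZR_lt; lia).
  assert (HbR : 1 <= IZR b) by (apply IZR_le; lia).
  set (la := ln (IZR (Z.abs a))) in *. set (lb := ln (IZR b)) in *.
  assert (Hlb : 0 <= lb) by (unfold lb; rewrite <- ln_1; apply ln_mono; lra).
  assert (Hla : 100 * M * ln C + 2 * (M + eps) * lb < eps * la).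
  { unfold Rpower in Habig. rewrite <- exp_plus in Habig. now apply exp_lt_inv in Habig. }
  assert (HMC : 0 <= 100 * M * ln C) by nra.
  assert (Hla0 : 0 < la) by nra.
  assert (Hlab : 0 < la - lb) by nra.
  assert (Hba : (b <= Z.abs a)%Z).
  { apply le_IZR. left. apply ln_lt_inv; unfold la, lb in *; lra. }
  set (v := padicQ p (inject_Z a)) in *.
  assert (Hv : 0 < v).
  { unfold v, padicQ. cbn [Qnum inject_Z].
    replace (Z.eqb a 0) with false by (symmetry; now apply Z.eqb_neq).
    apply powerRZ_lt. lra. }
  assert (HlG : (1 - eps / (8 * M)) * la <= ln (/ v)).
  { rewrite ln_Rinv by assumption. apply ln_increasing in Hsmall; [| assumption].
    unfold Rpower in Hsmall. rewrite ln_exp in Hsmall. fold la in Hsmall. lra. }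
  assert (Hlp : 0 < ln (IZR p)) by (rewrite <- ln_1; apply ln_increasing; lra).
  set (h1 := 100 * M / eps * (2 * ln K + ln (IZR p) + 3 * (M + 1) * la)).
  exists (exp h1). split; [apply exp_pos |].
  intros l Hl HH.
  assert (Hh0 : (1 <= h0 l m)%Z).
  { destruct Hl as (j & Hj & Hlj). pose proof (h0_ge l m j Hj). lia. }
  set (h := ln (IZR (Htilde l m))).
  assert (HHpos : 0 < IZR (Htilde l m)) by (pose proof (exp_pos h1); lra).
  assert (Hh : h1 <= h).
  { unfold h. rewrite <- (ln_exp h1). apply ln_mono; [apply exp_pos | lra]. }
  set (delta := eps / (4 * M)).
  assert (Hdelta : 0 <= delta) by (unfold delta; left; apply Rdiv_lt_0_compat; lra).
  destruct (balanced_indices m l (la - lb) delta Hlab Hdelta Hh0)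
    as (n & Hn1 & Hn0 & Hnl & Hnsum).
  fold h M in Hnl, Hnsum. set (N := LinearFormBound.nsum n m) in *.
  replace (INR m + 2) with (M + 1) in Hnsum by (unfold M; ring).
  destruct (exponent_budget M eps h la lb (ln (/ v)) (ln (IZR p)) (ln K) (ln C) (INR N))
    as (HX0 & HX1 & HX2); try assumption; try lra; try apply pos_INR.
  { split; [assumption |]. apply Rmult_le_reg_l with (r := 100 * M); [lra |].
    replace (100 * M * (eps / (100 * M) * la)) with (eps * la) by (field; lra). nra. }
  fold delta in HX0, HX1, HX2.
  (* Each term has logarithm ln |l_j| + N la - n_j (la - lb), which is at most N la - delta h by the
     choice of n_j. *)
  set (B := exp (INR N * la - delta * h)).
  set (X := ln K + INR N * ln C + INR N * la - delta * h) in *.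
  assert (HKCB : K * C ^ N * B = exp X).
  { rewrite exp_INR_ln by lra. rewrite <- (exp_ln K) at 1 by lra.
    unfold B. rewrite <- !exp_plus. f_equal. unfold X. ring. }
  (* p^w exceeds K C^N B strictly, but by a factor of at most p; this is the term ln p of the
     budget. *)
  destruct (nat_ceil (X / ln (IZR p))) as (w & _ & Hw1 & Hw2).
  { apply Rmult_le_pos; [assumption | left; now apply Rinv_0_lt_compat]. }
  assert (HXE : X / ln (IZR p) * ln (IZR p) = X) by (field; lra).
  assert (Hwlo : X < INR w * ln (IZR p)) by nra.
  assert (Hwhi : INR w * ln (IZR p) <= X + ln (IZR p)) by nra.
  assert (Hpw : IZR p ^ w = exp (INR w * ln (IZR p))) by (apply exp_INR_ln; lra).
  exists N. intros T HT.
  apply Rnot_le_gt. intros Hle.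
  assert (Hcontra : IZR p ^ w <= K * C ^ N * B).
  { apply (Hcore p a b Hp Hb Ha Hgcd Hba Hconv n l w T B Hn1 Hn0 Hl HT).
    - fold v N. rewrite Hpw, (exp_INR_ln C), (exp_INR_ln (/ v)); [| now apply Rinv_0_lt_compat | lra].
      rewrite <- (exp_ln K) by lra. rewrite <- !exp_plus. apply exp_le. lra.
    - apply Rle_trans with (1 := Hle). rewrite Hpw, <- exp_Ropp. unfold Rpower.
      apply exp_le. fold h. lra.
    - intros j Hj. fold N.
      destruct (Z.eq_dec (l j) 0) as [-> | Hlj].
      { cbn [Z.abs]. rewrite Rmult_0_l. left. apply exp_pos. }
      rewrite (exp_INR_ln (IZR (Z.abs a))), (exp_INR_ln (IZR b)) by lra.
      rewrite <- (exp_ln (IZR (Z.abs (l j)))) by (apply IZR_lt; lia).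
      rewrite <- !exp_plus. apply exp_le.
      rewrite minus_INR by (now apply nsum_ge). fold la lb.
      specialize (Hnl j Hj Hlj). lra. }
  rewrite HKCB, Hpw in Hcontra.
  pose proof (exp_increasing _ _ Hwlo). lra.
Qed.
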